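(* Let $(X,d,\mu)$ be a metric measure space. If $\mu$ is doubling and $X$ supports a weak $p$-Poincaré inequality, then Newtonian functions ($f\in N^{1,p}(X)$), Hajłasz–Sobolev functions ($f\in M^{1,p}(X)$) and $BV$ functions ($f\in BV(X)$) are approximately differentiable $\mu$-a.e. in $X$.
   Context: A metric measure space $(X,d,\mu)$ is a separable metric space $(X,d)$ with a non-trivial, locally finite Borel regular measure $\mu$. $B(x,r)=\{y\in X: d(x,y)<r\}$. The measure $\mu$ is doubling if there is $C_\mu>0$ with $\mu(B(x,2r))\le C_\mu\,\mu(B(x,r))$ for all $x\in X$, $r>0$. For $0<\mu(A)<\infty$, $f_A=\frac1{\mu(A)}\int_A f\,d\mu$. Upper gradients. A non-negative Borel function $g$ on $X$ is an upper gradient of an extended real-valued function $f$ on $X$ if $|f(\gamma(a))-f(\gamma(b))|\le\int_\gamma g$ for all rectifiable curves $\gamma:[a,b]\to X$. It is a $p$-weak upper gradient if this holds for all rectifiable curves except for a family of zero $p$-modulus, where the $p$-modulus of a curve family $\Gamma$ is $\inf\int_X\rho^p\,d\mu$ (for $p=\infty$: $\inf\|\rho\|_{L^\infty(X)}$) over non-negative Borel $\rho$ with $\int_\gamma\rho\ge1$ for all rectifiable $\gamma\in\Gamma$. Poincaré inequality. Let $1\le p\le\infty$. $X$ supports a weak $p$-Poincaré inequality if there are $\lambda_p\ge1$, $C_p>0$ such that for every measurable $f:X\to\mathbb{R}\cup\{-\infty,\infty\}$, every upper gradient $g:X\to[0,\infty]$ of $f$ and every ball $B(x,r)$, $$\frac1{\mu(B(x,r))}\int_{B(x,r)}|f-f_{B(x,r)}|\,d\mu\le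 C_p\,r\Big(\frac1{\mu(B(x,\lambda_p r))}\int_{B(x,\lambda_p r)}g^p\,d\mu\Big)^{1/p}$$ if $p<\infty$, and with the right-hand side replaced by $C_\infty\, r\,\|g\|_{L^\infty(B(x,\lambda_\infty r))}$ if $p=\infty$. Function spaces. $M^{1,p}(X)$ is the set of $f\in L^p(X)$ for which there is a positive function $g\in L^p(X)$ with $|f(x)-f(y)|\le d(x,y)(g(x)+g(y))$ $\mu$-a.e. $\widetilde N^{1,p}(X)$ is the class of $p$-integrable functions on $X$ having a $p$-weak upper gradient in $L^p(X)$, with $\|f\|_{\widetilde N^{1,p}}=\|f\|_{L^p}+\inf_g\|g\|_{L^p}$ (infimum over $p$-weak upper gradients $g$ of $f$), and $N^{1,p}(X)$ is the quotient of $\widetilde N^{1,p}(X)$ by the relation $f_1\sim f_2\iff\|f_1-f_2\|_{\widetilde N^{1,p}}=0$. $BV(X)$ (in the sense of Miranda) is the set of $f\in L^1(X)$ with finite total variation $$\|Df\|(X)=\inf\Big\{\liminf_{h\to\infty}\int_X|\nabla u_h|\,d\mu:\ u_h\text{ locally Lipschitz},\ u_h\to f\text{ in }L^1_{\mathrm{loc}}(X)\Big\},\qquad |\nabla u|(x)=\liminf_{\rho\to0}\sup_{y\in B(x,\rho)}\frac{|u(x)-u(y)|}{\rho}.$$ Differentiability. A point $x$ is a density point of $A$ if $\lim_{r\to0}\mu(B(x,r)\cap A)/\mu(B(x,r))=1$. The approximate limit of $F(y)$ as $y\to x$ is $l$ if for every $\varepsilon>0$ the point $x$ is a density point of $\{y:|F(y)-l|<\varepsilon\}$.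 An approximate differentiable structure on $(X,d,\mu)$ is a countable collection $\{(X_\alpha,\mathbf{x}_\alpha)\}_{\alpha\in\Lambda}$ of measurable sets $X_\alpha\subset X$ and Lipschitz maps $\mathbf{x}_\alpha:X\to\mathbb{R}^{N(\alpha)}$ such that: (i) $\mu(X\setminus\bigcup_\alpha X_\alpha)=0$; (ii) there is $N\ge0$ with $N(\alpha)\le N$ for all $\alpha$; (iii) for every Lipschitz $f:X\to\mathbb{R}$ and every $\alpha$ there is a unique (up to a set of measure zero) measurable bounded $d^\alpha f:X_\alpha\to\mathbb{R}^{N(\alpha)}$ such that for $\mu$-a.e. $x\in X_\alpha$ the quotient $$\frac{|f(y)-f(x)-d^\alpha f(x)\cdot(\mathbf{x}_\alpha(y)-\mathbf{x}_\alpha(x))|}{d(x,y)}$$ has approximate limit $0$ as $y\to x$. It is a strong measurable differentiable structure if in (iii) the approximate limit can be replaced by the ordinary limit as $y\to x$, $y\neq x$; by Cheeger's theorem such a structure exists if $\mu$ is doubling and $X$ supports a weak $p$-Poincaré inequality for some $1\le p<\infty$. Approximate differentiability is understood with respect to an approximate differentiable structure supported by $X$ (being approximately differentiable $\mu$-a.e. does not depend on which one is chosen): $f$ is approximately differentiable at $x\in X_\alpha$ if there is a vector $L^\alpha f(x)\in\mathbb{R}^{N(\alpha)}$ such that for every $\varepsilon>0$ the point $x$ is a density point of the set of $y$ with $|f(y)-f(x)-L^\alpha f(x)\cdot(\mathbf{x}_\alpha(y)-\mathbf{x}_\alpha(x))|<\varepsilon\, d(x,y)$.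
   Formalization: The BV part is stated only for p = 1 (weak 1-Poincaré inequality); for p > 1 it fails, e.g. on non-self-similar Sierpiński carpets with a in l^2 but not l^1, where suitable continuous functions of x alone are BV but nowhere approximately differentiable. *)

(* Defs.v *)
From HB Require Import structures.
From mathcomp Require Import all_boot all_order all_algebra.
From mathcomp Require Import all_classical all_reals all_analysis measurable_realfun.

Set Implicit Arguments.
Unset Strict Implicit.
Unset Printing Implicit Defensive.

Import Order.TTheory GRing.Theory Num.Theory.
Import numFieldNormedType.Exports.

Local Open Scope classical_set_scope.
Local Open Scope ring_scope.

(* The measurable structures of MathComp-Analysis live on pointed types.
   Pointedness costs no generality: a space carrying a non-trivial measure is
   nonempty. *)
#[short(type="pmetricType")]
HB.structure Definition PointedMetric (K : numDomainType) :=
  {M of Metric K M & Pointed M}.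

Section metric_measure_space.
Local Open Scope ereal_scope.
Context {R : realType} {X : pmetricType R}.

(* As usual in analysis on metric spaces, "Borel regular measure" means an
   outer measure for which Borel sets are measurable (in the sense of
   Caratheodory) and every set has a Borel hull of the same measure. *)
Definition borel_regular (mu : {outer_measure set X -> \bar R}) : Prop :=
  (forall B : set X, <<s @open X >> B -> mu.-caratheodory B) /\
  (forall A : set X, exists B : set X,
      [/\ <<s @open X >> B, A `<=` B & mu B = mu A]).

Definition separable_space : Prop :=
  exists2 D : set X, countable D & dense D.

Definition metric_measure_space (mu : {outer_measure set X -> \bar R}) : Prop :=
  [/\ separable_space,
      borel_regular mu,
      mu setT != 0 &
      forall x : X, exists2 r : R, (0 < r)%R & mu (ball x r) < +oo].

Definition doubling (mu : {outer_measure set X -> \bar R}) : Prop :=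
  exists2 C : R, (0 < C)%R &
    forall (x : X) (r : R), (0 < r)%R ->
      mu (ball x (2 * r)%R) <= C%:E * mu (ball x r).

(* mu as a (complete) measure on the sigma-algebra of mu-measurable sets *)
Definition cmeas (mu : {outer_measure set X -> \bar R}) :
    {measure set (caratheodory_type mu) -> \bar R} :=
  (mu : set (caratheodory_type mu) -> \bar R).

Definition mu_measurable_fun (mu : {outer_measure set X -> \bar R})
    (f : X -> \bar R) : Prop :=
  measurable_fun setT (f : caratheodory_type mu -> \bar R).

Definition borel_fun (g : X -> \bar R) : Prop :=
  measurable_fun setT (g : g_sigma_algebraType (@open X) -> \bar R).

(* only used for sets A with 0 < mu A < +oo *)
Definition avg (mu : {outer_measure set X -> \bar R}) (A : set X)
    (f : X -> \bar R) : \bar R :=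
  ((fine (mu A))^-1)%:E * \int[cmeas mu]_(x in A) f x.

Definition in_Lp (mu : {outer_measure set X -> \bar R}) (p : \bar R)
    (f : X -> \bar R) : Prop :=
  mu_measurable_fun mu f /\ 'N[cmeas mu]_p[f] < +oo.

End metric_measure_space.

Section curves.
Local Open Scope ereal_scope.
Context {R : realType} {X : pmetricType R}.

Record curve := Curve {
  lo : R ;
  hi : R ;
  path : R -> X ;
  lo_le_hi : (lo <= hi)%R ;
  path_continuous : {within `[lo, hi], continuous path} }.

Definition arc_length (gamma : R -> X) (a b : R) : \bar R :=
  ereal_sup [set (\sum_(0 <= n < size s)
      mdist (gamma (nth b (a :: s) n)) (gamma (nth b (a :: s) n.+1)))%:E
    | s in itv_partition a b].

Definition length (c : curve) : \bar R := arc_length (path c) (lo c) (hi c).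

Definition rectifiable (c : curve) : Prop := length c < +oo.

(* Arc-length parametrization of a rectifiable curve, on [0, length c]: the
   value at t is path c u for any u with arc_length (path c) (lo c) u = t (the
   path is constant on the set of such u). *)
Definition arc_param (c : curve) (t : R) : X :=
  path c (get [set u | (lo c <= u <= hi c)%R /\
                       arc_length (path c) (lo c) u = t%:E]).

Definition line_integral (c : curve) (g : X -> \bar R) : \bar R :=
  \int[@lebesgue_measure R]_(t in `[0%R, fine (length c)]) g (arc_param c t).

(* The difference of extended reals follows the usual convention for upper
   gradients: `|f x - f y| = +oo as soon as f x or f y is infinite.  With it,
   the inequality on constant curves would force f to be finite everywhere;
   constant curves are therefore disregarded, as is customary (for finite f
   they impose nothing). *)
Definition upper_gradient_along (f g : X -> \bar R) (c : curve) : Prop :=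
  `|f (path c (lo c)) - f (path c (hi c))| <= line_integral c g.

Definition upper_gradient (f g : X -> \bar R) : Prop :=
  [/\ borel_fun g,
      forall x, 0 <= g x &
      forall c, rectifiable c -> 0 < length c -> upper_gradient_along f g c].

Definition admissible (Gamma : set curve) (rho : X -> \bar R) : Prop :=
  [/\ borel_fun rho,
      forall x, 0 <= rho x &
      forall c, Gamma c -> rectifiable c -> 1 <= line_integral c rho].

(* for 1 <= p <= +oo *)
Definition modulus (mu : {outer_measure set X -> \bar R}) (p : \bar R)
    (Gamma : set curve) : \bar R :=
  if p is r%:E then
    ereal_inf [set \int[cmeas mu]_x (rho x `^ r) | rho in admissible Gamma]
  else ereal_inf [set 'N[cmeas mu]_+oo[rho] | rho in admissible Gamma].

Definition weak_upper_gradient (mu : {outer_measure set X -> \bar R})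
    (p : \bar R) (f g : X -> \bar R) : Prop :=
  [/\ borel_fun g,
      forall x, 0 <= g x &
      exists2 Gamma : set curve, modulus mu p Gamma = 0 &
        forall c, rectifiable c -> 0 < length c -> ~ Gamma c ->
          upper_gradient_along f g c].

(* for 1 <= p <= +oo: the p-mean of g over A, or its essential supremum on A *)
Definition p_mean (mu : {outer_measure set X -> \bar R}) (p : \bar R)
    (A : set X) (g : X -> \bar R) : \bar R :=
  if p is r%:E then (avg mu A (fun y => g y `^ r)) `^ (r^-1)
  else 'N[cmeas mu]_+oo[g \_ A].

(* If f is not integrable on the ball, its mean is infinite and so is the
   left-hand side. *)
Definition weak_poincare (mu : {outer_measure set X -> \bar R})
    (p : \bar R) : Prop :=
  exists lambda C : R, [/\ (1 <= lambda)%R, (0 < C)%R &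
    forall f g : X -> \bar R, mu_measurable_fun mu f -> upper_gradient f g ->
      forall (x : X) (r : R), (0 < r)%R ->
        avg mu (ball x r) (fun y => `|f y - avg mu (ball x r) f|)
        <= C%:E * r%:E * p_mean mu p (ball x (lambda * r)%R) g].

End curves.

Section function_spaces.
Local Open Scope ereal_scope.
Context {R : realType} {X : pmetricType R}.
Implicit Types (mu : {outer_measure set X -> \bar R}) (p : \bar R).

Definition hajlasz_sobolev mu p (f : X -> \bar R) : Prop :=
  in_Lp mu p f /\
  exists g : X -> \bar R,
    [/\ forall x, 0 < g x, in_Lp mu p g &
        exists2 E : set X, mu E = 0 &
          forall x y, ~ E x -> ~ E y ->
            `|f x - f y| <= (mdist x y)%:E * (g x + g y)].

(* representatives of the classes in N^{1,p} *)
Definition newtonian mu p (f : X -> \bar R) : Prop :=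
  in_Lp mu p f /\
  exists2 g : X -> \bar R, weak_upper_gradient mu p f g & in_Lp mu p g.

Definition locally_lipschitz (u : X -> R) : Prop :=
  forall x, exists r L : R, (0 < r)%R /\
    forall y z, ball x r y -> ball x r z ->
      (`|u y - u z| <= L * mdist y z)%R.

Definition lower_lip (u : X -> R) (x : X) : \bar R :=
  limf_einf (fun rho : R =>
    ereal_sup [set (`|u x - u y| / rho)%:E | y in ball x rho]) (0%R^'+).

Definition cvg_L1_loc mu (u : nat -> X -> R) (f : X -> \bar R) : Prop :=
  forall x : X, exists2 r : R, (0 < r)%R &
    (fun h => \int[cmeas mu]_(y in ball x r) `|(u h y)%:E - f y|) @ \oo --> 0%:E.

Definition total_variation_measure mu (f : X -> \bar R) : \bar R :=
  ereal_inf [set limn_einf (fun h => \int[cmeas mu]_x lower_lip (u h) x)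
    | u in [set u : nat -> X -> R |
              (forall h, locally_lipschitz (u h)) /\ cvg_L1_loc mu u f]].

Definition bounded_variation_fun mu (f : X -> \bar R) : Prop :=
  in_Lp mu 1 f /\ total_variation_measure mu f < +oo.

End function_spaces.

Section differentiability.
Context {R : realType} {X : pmetricType R}.
Implicit Types (mu : {outer_measure set X -> \bar R}).

Definition density_point mu (A : set X) (x : X) : Prop :=
  (fun r : R => fine (mu (ball x r `&` A)) / fine (mu (ball x r)))
    @ 0^'+ --> (1 : R).

(* The value of F at x itself plays no role. *)
Definition approx_limit mu (F : X -> R) (x : X) (l : R) : Prop :=
  forall e : R, 0 < e ->
    density_point mu [set y | y = x \/ `|F y - l| < e] x.

Definition lipschitz_map (V : normedModType R) (f : X -> V) : Prop :=
  exists L : R, forall x y, `|f x - f y| <= L * mdist x y.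

Definition dotrv n (v w : 'rV[R]_n) : R := \sum_(i < n) v 0 i * w 0 i.

Record chart_system := ChartSystem {
  chart_index : countType ;
  chart_set : chart_index -> set X ;
  chart_dim : chart_index -> nat ;
  chart_map : forall a : chart_index, X -> 'rV[R]_(chart_dim a) }.

(* d is a measurable bounded approximate differential of f on the chart a; only
   its values on chart_set S a are relevant. *)
Definition approx_differential mu (S : chart_system) (a : chart_index S)
    (f : X -> R) (d : X -> 'rV[R]_(chart_dim a)) : Prop :=
  [/\ forall i, measurable_fun (chart_set a : set (caratheodory_type mu))
                  ((fun x => d x 0 i) : caratheodory_type mu -> R),
      exists M : R, forall x, chart_set a x -> `|d x| <= M &
      {ae cmeas mu, forall x, chart_set a x ->
        approx_limit mu (fun y =>
          `|f y - f x - dotrv (d x) (chart_map a y - chart_map a x)|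
            / mdist x y) x 0}].

Definition approx_differentiable_structure mu (S : chart_system) : Prop :=
  [/\ forall a : chart_index S, mu.-caratheodory (chart_set a) /\
                                lipschitz_map (chart_map a),
      mu (~` \bigcup_(a : chart_index S) chart_set a) = 0%E,
      exists N : nat, forall a : chart_index S, (chart_dim a <= N)%N &
      forall f : X -> R, lipschitz_map (f : X -> R^o) ->
        forall a : chart_index S,
          exists2 d, approx_differential mu f d &
            forall d' : X -> 'rV[R]_(chart_dim a), approx_differential mu f d' ->
              {ae cmeas mu, forall x, chart_set a x -> d' x = d x}].

(* As in approx_limit, y = x is disregarded: the strict inequality fails
   there, which matters only if x is an atom. *)
Definition approx_differentiable_at mu (S : chart_system) (a : chart_index S)
    (f : X -> \bar R) (x : X) : Prop :=
  f x \is a fin_num /\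
  exists L : 'rV[R]_(chart_dim a), forall e : R, 0 < e ->
    density_point mu
      [set y | y = x \/
        (`|f y - f x - (dotrv L (chart_map a y - chart_map a x))%:E|
           < (e * mdist x y)%:E)%E] x.

Definition ae_approx_differentiable mu (S : chart_system) (f : X -> \bar R) :
    Prop :=
  {ae cmeas mu, forall x,
    (exists a : chart_index S, chart_set a x) /\
    (forall a : chart_index S, chart_set a x ->
       approx_differentiable_at mu a f x)}.

End differentiability.

Arguments curve {R} X.
Arguments chart_system {R} X.

(* Main.v *)
Require Import Defs.
From HB Require Import structures.
From mathcomp Require Import all_boot all_order all_algebra.
From mathcomp Require Import all_classical all_reals all_analysis measurable_realfun.
From mathcomp Require Import ring lra.

(** The three classes are handled by one mechanism.  A function that agrees,
    up to a null set, with countably many Lipschitz pieces is approximately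
    differentiable almost everywhere: each piece extends to a Lipschitz
    function on the whole space (McShane), which is approximately
    differentiable with respect to the structure, and at a density point of
    the piece the differential of the extension serves for the function too
    (lemma ae_approx_differentiable_lipschitz_pieces).  Almost every point of
    an arbitrary set, measurable or not, is a density point of it
    (lemma ae_density_point), so all pieces are covered.

    For a Hajlasz-Sobolev function with gradient g the pieces are the sets
    where g is at most n.

    For the other two classes the Poincare inequality produces the pieces.  Say
    that f has small oscillation at x with constant k when the mean oscillation
    of f over B(x,r) is at most k r for all r below 1/(k+1).  Telescoping the
    means over a dyadic sequence of balls shows that f is Lipschitz, at small
    distances, on the set of such x at which f is also approximately
    continuous.  It therefore suffices that almost every point has small
    oscillation for some k
    (lemma approx_differentiable_small_oscillation).  This follows from the
    Poincare inequality once the maximal function of a suitable finite set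
    function nu is finite almost everywhere, which is the weak type estimate
    given by a Vitali covering (lemmas weak_type and ae_maximal_finite).
    The estimate uses only that the sum of nu over disjoint balls is bounded.

    In the Newtonian case, a p-weak upper gradient is first enlarged to a
    genuine upper gradient G in L^p: a family of modulus zero has admissible
    functions rho_n of tiny norm, and the supremum of g and of all n rho_n has
    infinite integral along every exceptional curve.  Then nu(A) is the
    integral of G^p over A (for p infinite G is essentially bounded, and no maximal
    function is needed).

    In the BV case, take locally Lipschitz u_h that converge to f in L^1_loc
    with bounded energies.  The lower Lipschitz constant of u_h is an upper
    gradient of u_h (lemma lower_lip_upper_gradient), so the 1-Poincare
    inequality holds for the pair.  Here nu(A) is the lower limit of the
    energies of u_h in A; it is only superadditive on disjoint sets, but this is
    all that the weak type estimate asks for.  On a ball where nu is bounded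
    by k times mu, the Poincare inequality for a late u_h passes to f by L^1
    closeness. *)

Set Implicit Arguments.
Unset Strict Implicit.
Unset Printing Implicit Defensive.

Import Order.TTheory GRing.Theory Num.Theory.
Import numFieldNormedType.Exports.

Local Open Scope classical_set_scope.
Local Open Scope ring_scope.

(** * Coverings and the weak type estimate in a doubling space *)

Section metric_geometry.
Context {R : realType} {X : pmetricType R}.
Implicit Types (x y z : X) (r s : R).

Lemma in_ball x r y : ball x r y = (mdist x y < r) :> Prop.
Proof. by rewrite ballEmdist. Qed.

Lemma open_metric_ball x r : open (ball x r).
Proof.
rewrite openE => y; rewrite in_ball => xy.
rewrite /interior -nbhs_ballE; exists (r - mdist x y) => /=; first by rewrite subr_gt0.
by move=> z; rewrite !in_ball; have := metric_triangle x y z; lra.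
Qed.

(** Vitali selection by Zorn's lemma.  The
    admissible subfamilies are disjoint and have the following closure
    property: every ball of F that meets the subfamily also meets one of its
    members of at least half its radius.  A maximal one meets everything, for
    otherwise a ball of nearly largest radius among those that it misses could
    be added. *)
Lemma vitali_disjoint_subfamily (F : set (X * R)) (K : R) :
  (forall b, F b -> 0 < b.2 <= K) ->
  exists G : set (X * R), [/\ G `<=` F,
    forall a b, G a -> G b -> ball a.1 a.2 `&` ball b.1 b.2 !=set0 -> a = b &
    forall b, F b -> exists a, [/\ G a, ball b.1 b.2 `&` ball a.1 a.2 !=set0 &
      b.2 <= 2 * a.2]].
Proof.
move=> FK.
pose meets (a b : X * R) := ball a.1 a.2 `&` ball b.1 b.2 !=set0.
pose P (G : set (X * R)) := [/\ G `<=` F,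
  forall a b, G a -> G b -> meets a b -> a = b &
  forall b, F b -> (exists2 a, G a & meets b a) ->
    exists a, [/\ G a, meets b a & b.2 <= 2 * a.2]].
have [|G [[GF Gd Gc] Gmax]] := @Zorn_bigcup _ P.
  move=> C CP Ctot; split.
  - by move=> b [G CG Gb]; have [GF _ _] := CP _ CG; exact: GF.
  - move=> a b [G CG Ga] [H CH Hb] ab.
    have [GH|HG] := Ctot _ _ CG CH.
    + by have [_ Hd _] := CP _ CH; apply: Hd => //; exact: GH.
    + by have [_ Gd _] := CP _ CG; apply: Gd => //; exact: HG.
  - move=> b Fb [a [G CG Ga] ba]; have [_ _ Gc] := CP _ CG.
    have [|a' [Ga' ba' ?]] := Gc _ Fb; first by exists a.
    by exists a'; split => //; exists G.
exists G; split => // b Fb; apply: (Gc) => //.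
apply: contrapT => nob.
(* The balls that the maximal subfamily misses: one of radius above half their supremum can be added. *)
pose N := [set c | F c /\ forall a, G a -> ~ meets c a].
have Nb : N b by split => // a Ga ba; apply: nob; exists a.
pose S := [set c.2 | c in N].
have S0 : S !=set0 by exists b.2, b.
have SK : has_sup S.
  by split => //; exists K => _ [c [Fc _] <-]; have /andP[] := FK _ Fc.
have supS0 : 0 < sup S.
  have /andP[b0 _] := FK _ Fb; apply: lt_le_trans b0 _.
  by apply: ub_le_sup; [exact: SK.2|exists b].
have [c' [c [Fc Nc] <-] cS] := sup_adherent (divr_gt0 supS0 (@ltr0n R 2)) SK.
have cS' : sup S < 2 * c.2 by lra.
have Gc0 : ~ G c.
  move=> /Nc; apply; exists c.1; have /andP[c0 _] := FK _ Fc.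
  by split; exact: ballxx.
apply: (Gmax (G `|` [set c])).
  by split; [left|move=> /(_ c (or_intror erefl))].
split.
- by move=> a [/GF//|->].
- move=> a a' [Ga|->] [Ga'|->] //; first exact: Gd.
  + by move=> ac; case: (Nc _ Ga); rewrite /meets setIC.
  + by move=> ca; case: (Nc _ Ga').
- move=> d Fd [a0 Ga0 da0].
  have [[a Ga da]|Nd] := pselect (exists2 a, G a & meets d a).
    have [|a' [Ga' da' ?]] := Gc _ Fd; first by exists a.
    by exists a'; split => //; left.
  case: Ga0 da0 => [Ga0 da0|-> dc]; first by case: Nd; exists a0.
  exists c; split => //; first by right.
  apply: ltW; apply: le_lt_trans cS'; apply: ub_le_sup; first exact: SK.2.
  by exists d => //; split => // a Ga da; apply: Nd; exists a.
Qed.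

Lemma ball_sub_meeting (a b : X * R) : ball b.1 b.2 `&` ball a.1 a.2 !=set0 ->
  b.2 <= 2 * a.2 -> ball b.1 b.2 `<=` ball a.1 (2 * (2 * (2 * a.2))).
Proof.
move=> [z []]; rewrite !in_ball => bz az ba y; rewrite !in_ball => by_.
have a0 : 0 < a.2 by apply: le_lt_trans az; exact: mdist_ge0.
have := metric_triangle a.1 z y; have := metric_triangle z b.1 y.
rewrite (metric_sym z b.1); lra.
Qed.

(** Each ball contains a point of a countable dense set, and disjoint balls
    contain different ones. *)
Lemma countable_disjoint_balls (G : set (X * R)) : @separable_space R X ->
  (forall a, G a -> 0 < a.2) ->
  (forall a b, G a -> G b -> ball a.1 a.2 `&` ball b.1 b.2 !=set0 -> a = b) ->
  countable G.
Proof.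
move=> [D cD dD] G0 Gd.
have /countable_injP[f finj] := cD.
have hit a : G a -> exists x, D x /\ ball a.1 a.2 x.
  move=> Ga; have [||x [? ?]] := dD (ball a.1 a.2); last by exists x.
  - by exists a.1; apply: ballxx; exact: G0.
  - exact: open_metric_ball.
pose h a := get [set x | D x /\ ball a.1 a.2 x].
have hP a : G a -> D (h a) /\ ball a.1 a.2 (h a).
  by move=> Ga; have [x Hx] := hit _ Ga; exact: (@getI _ [set x | D x /\ ball a.1 a.2 x] x).
apply/countable_injP; exists (f \o h) => a b; rewrite !inE => Ga Gb /= fab.
have [Da ha] := hP _ Ga; have [Db hb] := hP _ Gb.
apply: Gd => //; exists (h a); split => //.
by rewrite (finj (h a) (h b)) ?inE.
Qed.

Lemma separable_lindelof_small (e : R) : @separable_space R X -> 0 < e ->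
  exists c : nat -> X, forall x, exists n, ball (c n) e x.
Proof.
move=> [D cD dD] e0.
have /countable_injP[f finj] := cD.
exists (fun n => get [set x | D x /\ f x = n]) => x.
have [||y [xy Dy]] := dD (ball x e).
- by exists x; exact: ballxx.
- exact: open_metric_ball.
exists (f y).
have [Dz fz] : [set x | D x /\ f x = f y] (get [set x | D x /\ f x = f y]).
  by apply: (@getI _ [set x | D x /\ f x = f y] y).
rewrite [X in ball X](finj _ y) ?inE//; exact: ball_sym.
Qed.
End metric_geometry.

Section doubling_measure.
Context {R : realType} {X : pmetricType R}.
Variable mu : {outer_measure set X -> \bar R}.
Hypothesis hX : metric_measure_space mu.
Hypothesis hdbl : doubling mu.
Implicit Types (x y z : X) (r s : R).
Local Open Scope ereal_scope.

Lemma open_caratheodory (A : set X) : open A -> mu.-caratheodory A.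
Proof. by case: hX => _ [bc _] _ _ oA; apply: bc; exact: sub_sigma_algebra. Qed.

Lemma ball_caratheodory x r : mu.-caratheodory (ball x r).
Proof. by apply: open_caratheodory; exact: open_metric_ball. Qed.

Lemma doubling_iter : exists2 C : R, (0 < C)%R & forall x r n, (0 < r)%R ->
  mu (ball x (2 ^+ n * r)) <= (C ^+ n)%:E * mu (ball x r).
Proof.
have [C C0 hC] := hdbl; exists C => // x r n r0; elim: n => [|n IH].
  by rewrite !expr0 mul1r mul1e.
rewrite exprS -mulrA; apply: le_trans (hC _ _ _) _.
  by rewrite mulr_gt0// exprn_gt0.
by rewrite exprS EFinM -muleA lee_pmul2l// fin_numE.
Qed.

Lemma ball_exhaust x y r s : (0 < r)%R -> exists n, ball y s `<=` ball x (2 ^+ n * r).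
Proof.
move=> r0.
have [n _ Hn] : \forall n \near \oo, ((mdist x y + s) / r < n%:R)%R.
  exact: nbhs_infty_gtr.
exists n => z; rewrite !in_ball => yz; have := metric_triangle x y z.
have : (n%:R <= 2 ^+ n :> R)%R by rewrite -natrX ler_nat ltnW// ltn_expl.
have := Hn n (leqnn n); rewrite ltr_pdivrMr// => H1 H2 H3.
apply: le_lt_trans H3 _; apply: lt_le_trans (_ : n%:R * r <= _)%R; last by rewrite ler_pM2r.
by apply: lt_trans H1; rewrite ltrD2l.
Qed.

(** Local finiteness gives one ball of finite measure at x, and doubling
    carries this to all larger balls. *)
Lemma mu_ball_fin x r : mu (ball x r) < +oo.
Proof.
case: hX => _ _ _ lf; have [r0 r00 fin] := lf x.
have [C C0 hC] := doubling_iter; have [n /(le_outer_measure mu) Hn] := ball_exhaust x x r r00.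
apply: le_lt_trans Hn _; apply: le_lt_trans (hC _ _ _ r00) _.
by rewrite lte_mul_pinfty// lee_fin ltW// exprn_gt0.
Qed.

Lemma mu_ball_fin_num x r : mu (ball x r) \is a fin_num.
Proof. by rewrite ge0_fin_numE ?mu_ball_fin. Qed.

(** A ball of measure zero would, by doubling, have all its dilates null,
    hence the whole space. *)
Lemma mu_ball_gt0 x r : (0 < r)%R -> 0 < mu (ball x r).
Proof.
move=> r0; rewrite lt_neqAle outer_measure_ge0 andbT; apply/eqP => /esym mu0.
case: hX => _ _ /eqP + _; apply.
have [C C0 hC] := doubling_iter.
apply/eqP; rewrite eq_le outer_measure_ge0 andbT.
apply: (@le_trans _ _ (mu (\bigcup_n ball x (2 ^+ n * r)))).
  apply: le_outer_measure => y _; have [n Hn] := ball_exhaust x y 1 r0.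
  by exists n => //; apply: Hn; exact: ballxx.
apply: le_trans (outer_measure_sigma_subadditive mu _) _.
rewrite eseries0// => n _ _; apply/eqP; rewrite eq_le outer_measure_ge0 andbT.
by apply: le_trans (hC _ _ _ r0) _; rewrite mu0 mule0.
Qed.

(** The weak type estimate behind the maximal theorem.  It is stated for a set
    function nu of which only the sums over finite disjoint families are
    controlled, because the lower limit of energies used for BV functions is
    not additive.  The constant is the cube of the doubling constant, as the
    selected balls are dilated by 8. *)
Lemma weak_type : exists2 C : R, (0 < C)%R &
  forall (F : set (X * R)) (Z : set X) (nu : set X -> \bar R) (t K : R) (V : \bar R),
  (0 <= t)%R -> (forall A, 0 <= nu A) -> (forall b, F b -> (0 < b.2 <= K)%R) ->
  Z `<=` \bigcup_(b in F) ball b.1 b.2 ->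
  (forall b, F b -> t%:E * mu (ball b.1 b.2) <= nu (ball b.1 b.2)) ->
  (forall s : seq (X * R), uniq s -> {in s, forall b, F b} ->
    {in s &, forall a b, a != b -> ball a.1 a.2 `&` ball b.1 b.2 = set0} ->
    \sum_(b <- s) nu (ball b.1 b.2) <= V) ->
  t%:E * mu Z <= C%:E * V.
Proof.
have [C C0 hC] := doubling_iter; exists (C ^+ 3)%R; first by rewrite exprn_gt0.
move=> F Z nu t K V t0 nu0 FK ZF Fnu FV.
have [G [GF Gd Gc]] := vitali_disjoint_subfamily FK.
have G0 a : G a -> (0 < a.2)%R by move=> /GF /FK/andP[].
have /countable_injP[f finj] : countable G.
  by apply: countable_disjoint_balls => //; case: hX.
(* Enumeration of the countable disjoint subfamily G through the injection f. *)
pose g n : option (X * R) := if pselect (exists2 b, G b & f b = n) is left _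
  then Some (get [set b | G b /\ f b = n]) else None.
have gP n b : g n = Some b -> G b /\ f b = n.
  rewrite /g; case: pselect => // -[c Gc' fc] [<-].
  exact: (@getI _ [set b | G b /\ f b = n] c).
have gf b : G b -> g (f b) = Some b.
  move=> Gb; rewrite /g; case: pselect => [_|[]]; last by exists b.
  congr Some; have [] : [set c | G c /\ f c = f b] (get [set c | G c /\ f c = f b]).
    exact: (@getI _ [set c | G c /\ f c = f b] b).
  by move=> /= ? ?; apply: finj; rewrite ?inE.
pose B n := if g n is Some b then ball b.1 (2 * (2 * (2 * b.2))) else set0.
have ZB : Z `<=` \bigcup_n B n.
  move=> z /ZF[b Fb bz]; have [a [Ga ba ab]] := Gc _ Fb.
  by exists (f a) => //; rewrite /B gf//; exact: (ball_sub_meeting ba ab).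
apply: le_trans (lee_wpmul2l _ (le_outer_measure mu _ _ ZB)) _; first by rewrite lee_fin.
apply: le_trans (lee_wpmul2l _ (outer_measure_sigma_subadditive mu B)) _; first by rewrite lee_fin.
rewrite -nneseriesZl//.
apply: lime_le; first by apply: is_cvg_nneseries => n _ _; rewrite mule_ge0.
apply: nearW => N.
pose s := pmap g (iota 0 N).
apply: (@le_trans _ _ (\sum_(b <- s) (C ^+ 3)%:E * nu (ball b.1 b.2))).
  rewrite /s /index_iota subn0; elim: (iota 0 N) => [|n l IH].
    by rewrite !big_nil.
  rewrite big_cons /= /B; case gn : (g n) => [b|] /=; last by rewrite outer_measure0 mule0 add0e.
  rewrite big_cons leeD//; have [Gb fb] := gP _ _ gn.
  apply: (@le_trans _ _ ((C ^+ 3)%:E * (t%:E * mu (ball b.1 b.2)))).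
    rewrite muleCA lee_wpmul2l ?lee_fin//.
    have := hC b.1 b.2 3%N (G0 _ Gb); apply: le_trans.
    by rewrite (_ : 2 * _ = 2 ^+ 3 * b.2)%R//; ring.
  by rewrite lee_wpmul2l ?lee_fin ?exprn_ge0 ?(ltW C0)//; apply: Fnu; exact: GF.
rewrite -ge0_sume_distrr//; apply: lee_wpmul2l; first by rewrite lee_fin exprn_ge0// ltW.
have sG b : b \in s -> G b.
  by rewrite /s mem_pmap => /mapP[n _ /esym/gP[]].
apply: FV => [|b /sG /GF//|a b /sG Ga /sG Gb ab].
  apply: (@pmap_uniq _ _ g f _ _ (iota_uniq _ _)) => n; rewrite /oapp.
  by case gn : (g n) => [b|//]; have [] := gP _ _ gn.
apply/eqP/negPn/negP => /set0P ab0; move/eqP: ab; apply.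
exact: Gd.
Qed.
End doubling_measure.

(** * Density points of arbitrary sets *)

Section density.
Context {R : realType} {X : pmetricType R}.
Variable mu : {outer_measure set X -> \bar R}.
Hypothesis hX : metric_measure_space mu.
Hypothesis hdbl : doubling mu.
Implicit Types (x y z : X) (r s : R).
Local Open Scope ereal_scope.

Lemma mu_eq0 (A : set X) : mu A <= 0 -> mu A = 0.
Proof. by move=> A0; apply/eqP; rewrite eq_le A0 outer_measure_ge0. Qed.

Lemma mu_sub0 (A B : set X) : A `<=` B -> mu B = 0 -> mu A = 0.
Proof. by move=> AB B0; apply: mu_eq0; rewrite -B0; exact: le_outer_measure. Qed.

Lemma mu_bigcup0 (A : nat -> set X) : (forall n, mu (A n) = 0) -> mu (\bigcup_n A n) = 0.
Proof.
move=> A0; apply: mu_eq0; apply: le_trans (outer_measure_sigma_subadditive mu _) _.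
by rewrite eseries0.
Qed.

Lemma mu_setU0 (A B : set X) : mu A = 0 -> mu B = 0 -> mu (A `|` B) = 0.
Proof.
move=> A0 B0; apply: mu_eq0; apply: le_trans (outer_measureU2 mu _ _) _.
by rewrite A0 B0 adde0.
Qed.

Lemma null_caratheodory (A : set X) : mu A = 0 -> mu.-caratheodory A.
Proof.
move=> A0; apply: le_caratheodory_measurable => Y.
rewrite (_ : mu (Y `&` A) = 0) ?add0e; first by apply: le_outer_measure => ? [].
by apply: mu_sub0 A0 => ? [].
Qed.

Lemma ae_null (P : X -> Prop) :
  {ae cmeas mu, forall x, P x} <-> mu (~` [set x | P x]) = 0.
Proof.
split=> [[N [mN N0 PN]]|P0]; first exact: mu_sub0 N0.
by exists (~` [set x | P x]); split => //; exact: null_caratheodory.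
Qed.

(** Continuity of the measure from above, for a sequence with empty
    intersection. *)
Lemma mu_decreasing0 (A : nat -> set X) e : (forall n, mu.-caratheodory (A n)) ->
  (forall n, A n.+1 `<=` A n) -> mu (A 0%N) < +oo -> \bigcap_n A n = set0 ->
  (0 < e)%R -> exists n, mu (A n) <= e%:E.
Proof.
move=> cA dA fA A0 e0.
have ndA : nonincreasing_seq A.
  by apply/nonincreasing_seqP => n; apply/subsetPset; exact: dA.
have := @nonincreasing_cvg_mu _ (caratheodory_type mu) R (cmeas mu) A fA cA.
rewrite A0 measure0 => /(_ measurable0 ndA) /fine_cvgP[_].
move=> /cvgr0_norm_le /(_ _ e0)[n _ /(_ n (leqnn n))] /= H.
exists n; have fn : mu (A n) \is a fin_num.
  rewrite ge0_fin_numE//; apply: le_lt_trans fA; apply: le_outer_measure.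
  by apply/subsetPset; exact: ndA.
by rewrite -(fineK fn) lee_fin; apply: le_trans (ler_norm _) H.
Qed.

(** The measurable sets B i split the outer measure of Y one after another. *)
Lemma sum_disjoint_trace (I : eqType) (B : I -> set X) (Y : set X) (s : seq I) :
  uniq s -> (forall i, mu.-caratheodory (B i)) ->
  {in s &, forall a b, a != b -> B a `&` B b = set0} ->
  \sum_(i <- s) mu (B i `&` Y) <= mu (\bigcup_(i in [set` s]) B i `&` Y).
Proof.
elim: s => [|a s IH] /=; first by rewrite big_nil.
move=> /andP[nas us] cB dB; rewrite big_cons.
rewrite [leRHS](cB a); apply: leeD.
  by apply: le_outer_measure => y [By Yy]; split => //; split => //; exists a => //=; exact: mem_head.
apply: le_trans (IH us cB _) _.
  by move=> i j si sj; apply: dB; rewrite inE ?si ?sj orbT.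
apply: le_outer_measure => y [[i /= si Biy] Yy]; split.
  by split => //; exists i => //=; rewrite inE si orbT.
move=> Bay; have ai : a != i by apply: contra nas => /eqP ->.
have : (B a `&` B i) y by [].
by rewrite dB// inE ?eqxx ?si ?orbT.
Qed.

(** Approximation of A from outside by open sets and from inside by closed
    sets, with the error measured inside W only, so that W of finite measure
    makes the finite theory available. *)
Definition tight_on (W A : set X) := forall e : R, (0 < e)%R ->
  exists U F, [/\ open U, closed F, F `<=` A, A `<=` U & mu ((U `\` F) `&` W) <= e%:E].

(** An open set is the increasing union of the closed sets of points at
    distance at least 1/n from its complement. *)
Lemma tight_open (W U : set X) : mu.-caratheodory W -> mu W < +oo -> open U -> tight_on W U.
Proof.
move=> cW fW oU e e0.
pose V n := \bigcup_(y in ~` U) ball y (n.+1%:R^-1 : R).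
have oV n : open (V n) by apply: bigcup_open => y _; exact: open_metric_ball.
have [|||| n Hn] := @mu_decreasing0 (fun n => (U `\` ~` V n) `&` W) e _ _ _ _ e0.
- move=> n; rewrite setDE setCK; apply: caratheodory_measurable_setI => //.
  by apply: caratheodory_measurable_setI; exact: open_caratheodory.
- move=> n x [[Ux nVx] Wx]; split => //; split => // Vx; apply: nVx => -[y Uy yx]; apply: Vx.
  exists y => //; apply: le_ball yx; rewrite lef_pV2 ?ler_nat// posrE ltr0n//.
- by apply: le_lt_trans fW; apply: le_outer_measure => ? [].
- apply/seteqP; split => // x Hx.
  have [[Ux _] _] := Hx 0%N I.
  have /nbhs_ballP[d /= d0 dU] : nbhs x U by apply: open_nbhs_nbhs.
  have nd : (d^-1 < (Num.truncn d^-1).+1%:R)%R by exact: truncnS_gt.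
  have [[_ /contrapT [y Uy yx]] _] := Hx (Num.truncn d^-1) I.
  apply: Uy; apply: dU; apply: ball_sym; apply: le_ball yx.
  rewrite invf_ple ?posrE// ltW//.
exists U, (~` V n); split => //.
- by apply: open_closedC.
- by move=> x nV; apply: contrapT => Ux; apply: nV; exists x => //; apply: ballxx; rewrite invr_gt0.
Qed.

(** The sets that can be approximated form a sigma-algebra.  For a countable
    union the open sets are united, while only finitely many of the closed sets
    are kept, so that their union remains closed. *)
Lemma tight_borel (W A : set X) : mu.-caratheodory W -> mu W < +oo ->
  <<s @open X >> A -> tight_on W A.
Proof.
move=> cW fW; apply: (@smallest_sub _ _ _ (tight_on W)); last first.
  by move=> U oU; exact: tight_open.
split.
- move=> e e0; exists set0, set0; split => //; [exact: open0|exact: closed0|].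
  by rewrite setDv set0I outer_measure0 lee_fin ltW.
- move=> B tB e e0; have [U [F [oU cF FB BU m]]] := tB e e0.
  exists (~` F), (~` U); split.
  + exact: closed_openC.
  + exact: open_closedC.
  + by rewrite setTD; apply: subsetC.
  + by rewrite setTD; apply: subsetC.
  + by move: m; rewrite !setDE setCK (setIC U).
- move=> B tB e e0.
  have e20 : (0 < e / 2)%R by rewrite divr_gt0.
  have /choice[U /choice[F UF]] n : exists U, exists F,
    [/\ open U, closed F, F `<=` B n, B n `<=` U &
        mu ((U `\` F) `&` W) <= ((e / 2) / (2 ^ n.+1)%:R)%:E].
    have [|U [F H]] := tB n ((e / 2) / (2 ^ n.+1)%:R)%R; last by exists U, F.
    by rewrite divr_gt0// ltr0n expn_gt0.
  pose FN N := \bigcup_(n in `I_N) F n.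
  have cFN N : closed (FN N).
    by apply: closed_bigcup => // n _; case: (UF n).
  have cbFN N : mu.-caratheodory (FN N).
    rewrite -(setCK (FN N)); apply: caratheodory_measurable_setC.
    by apply: open_caratheodory => //; exact: closed_openC.
  have cF n : mu.-caratheodory (F n).
    rewrite -(setCK (F n)); apply: caratheodory_measurable_setC.
    by apply: open_caratheodory => //; apply: closed_openC; case: (UF n).
  have [|||| N HN] := @mu_decreasing0 (fun N => ((\bigcup_n F n) `\` FN N) `&` W) (e / 2)%R _ _ _ _ e20.
  + move=> N; apply: caratheodory_measurable_setI => //.
    apply: caratheodory_measurable_setD => //.
    exact: caratheodory_measurable_bigcup.
  + move=> N x [[Ux Fx] Wx]; split => //; split => // -[n /= nN Fnx]; apply: Fx.
    by exists n => //=; exact: ltnW.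
  + by apply: le_lt_trans fW; apply: le_outer_measure => ? [].
  + apply/seteqP; split => // x Hx; have [[[n _ Fx] _] _] := Hx 0%N I.
    by have [[_ /(_ (ex_intro2 _ _ n (ltnSn n) Fx))]] := Hx n.+1 I.
  exists (\bigcup_n U n), (FN N); split => //.
  + by apply: bigcup_open => n _; case: (UF n).
  + by move=> x [n _ Fx]; exists n => //; case: (UF n) => _ _ + _ _; exact.
  + by apply: subset_bigcup => n _; case: (UF n).
  apply: (@le_trans _ _ (mu ((\bigcup_n ((U n `\` F n) `&` W)) `|`
     ((\bigcup_n F n `\` FN N) `&` W)))).
    apply: le_outer_measure => x [[[n _ Ux] Fx] Wx].
    have [Fnx|Fnx] := pselect ((\bigcup_n F n) x); first by right.
    by left; exists n => //; split => //; split => // ?; apply: Fnx; exists n.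
  apply: le_trans (outer_measureU2 mu _ _) _.
  rewrite (splitr e) EFinD leeD//.
  apply: le_trans (outer_measure_sigma_subadditive mu _) _.
  rewrite -[leRHS]add0e.
  have := @epsilon_trick R (fun=> 0) (e / 2)%R xpredT (fun=> lexx _) (ltW e20).
  rewrite [X in _ <= X + _ -> _]eseries0// => H; apply: le_trans H.
  by apply: lee_nneseries => // n _; rewrite add0e; case: (UF n).
Qed.

Lemma at_right0P (P : R -> Prop) :
  (\forall r \near 0%R^'+, P r) <-> exists2 d, (0 < d)%R & forall r, (0 < r < d)%R -> P r.
Proof.
split=> [|[d d0 Hd]].
- rewrite near_withinE => /nbhs_ballP[d /= d0 Hd]; exists d => // r /andP[r0 rd].
  by apply: Hd => //; rewrite /ball/= sub0r normrN gtr0_norm.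
- near=> r; apply: Hd; apply/andP; split; near: r; [exact: nbhs_right_gt|exact: nbhs_right_lt].
Unshelve. all: by end_near.
Qed.

(** Quotients are inconvenient to compare; the density condition is
    turned into an inequality between measures.  The upper bound by 1 is
    automatic. *)
Lemma density_pointP (A : set X) x :
  (forall e, (0 < e)%R -> exists2 d, (0 < d)%R & forall r, (0 < r < d)%R ->
     (1 - e)%:E * mu (ball x r) <= mu (ball x r `&` A)) <-> density_point mu A x.
Proof.
have fb r : mu (ball x r) \is a fin_num by exact: mu_ball_fin_num.
have fA r : mu (ball x r `&` A) \is a fin_num.
  rewrite ge0_fin_numE//; apply: le_lt_trans (mu_ball_fin hX hdbl x r).
  by apply: le_outer_measure => ? [].
have b0 r : (0 < r)%R -> (0 < fine (mu (ball x r)))%R.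
  by move=> r0; rewrite fine_gt0// mu_ball_gt0//= mu_ball_fin.
split=> H.
- rewrite /density_point; apply/cvgrPdist_le => e e0.
  have [d d0 Hd] := H _ e0.
  near=> r.
  have r0 : (0 < r)%R by near: r; exact: nbhs_right_gt.
  have rd : (r < d)%R by near: r; exact: nbhs_right_lt.
  have := Hd r; rewrite r0 rd => /(_ isT).
  rewrite -(fineK (fb r)) -(fineK (fA r)) -EFinM lee_fin => Hr.
  have Hr' : (fine (mu (ball x r `&` A)) <= fine (mu (ball x r)))%R.
    by rewrite fine_le//; apply: le_outer_measure => ? [].
  rewrite ger0_norm; last by rewrite subr_ge0 ler_pdivrMr ?mul1r ?b0.
  by rewrite lerBlDr -lerBlDl ler_pdivlMr ?b0.
- move=> e e0.
  move/cvgrPdist_le : H => /(_ e e0) /at_right0P[d d0 Hd].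
  exists d => // r rd; have := Hd r rd; have /andP[r0 _] := rd.
  rewrite -{2}(fineK (fb r)) -(fineK (fA r)) -EFinM lee_fin.
  move=> /(le_trans (ler_norm _)).
  by rewrite lerBlDr -lerBlDl ler_pdivlMr ?b0.
Unshelve. all: by end_near.
Qed.

(** Lebesgue's density theorem for an arbitrary set E, measurable or not.  A
    Borel hull H of E has the same trace measure as E on every ball inside W,
    so it is enough to treat H.  Points of low density of H are covered by
    balls in which the complement of H has at least a fixed proportion t of the
    measure.  These balls can be chosen inside an open U that contains H and
    exceeds it very little, and the weak type estimate bounds their union. *)
Lemma ae_density_point (E : set X) : mu (E `&` [set x | ~ density_point mu E x]) = 0.
Proof.
have [C C0 hC] := weak_type hX hdbl.
pose Z n k := [set x | [/\ E x, ball point (2 ^+ n * 1)%R x &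
   forall d : R, (0 < d)%R -> exists2 r, (0 < r < d)%R &
     mu (ball x r `&` E) < (1 - k.+1%:R^-1)%:E * mu (ball x r)]].
suff Z0 n k : mu (Z n k) = 0.
  apply: (@mu_sub0 _ (\bigcup_n \bigcup_k Z n k)); last first.
    by apply: mu_bigcup0 => n; apply: mu_bigcup0.
  move=> x [Ex ndx].
  have [n Hn] := @ball_exhaust _ _ point x 1 1 ltr01.
  exists n => //.
  apply: contrapT => nZ; apply: ndx; apply/density_pointP => e e0.
  pose k := Num.truncn (e^-1).
  have ke : (k.+1%:R^-1 <= e)%R.
    by rewrite invf_ple ?posrE// ltW// truncnS_gt.
  apply: contrapT => nd; apply: nZ; exists k => //; split => //.
    by apply: Hn; apply: ballxx.
  move=> d d0; apply: contrapT => nr; apply: nd; exists d => // r rd.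
  rewrite leNgt; apply/negP => H; apply: nr; exists r => //.
  apply: lt_le_trans H _; apply: lee_wpmul2r => //.
  by rewrite lee_fin lerB.
pose W : set X := ball point (2 ^+ n * 1 : R)%R; pose t : R := (k.+1%:R^-1)%R.
have t0 : (0 < t)%R by rewrite invr_gt0.
have [_ [bc hull] _ _] := hX.
have [H [bH EH mH]] := hull (E `&` W).
have cW : mu.-caratheodory W by exact: ball_caratheodory.
have fW : mu W < +oo by exact: mu_ball_fin.
have fEW : mu (E `&` W) < +oo.
  by apply: le_lt_trans fW; apply: le_outer_measure => ? [].
(* The hull cannot gain measure on a measurable part of W, since it gains none in total. *)
have traceH x r : ball x r `<=` W -> mu (ball x r `&` H) = mu (ball x r `&` E).
  move=> BW; apply/eqP; rewrite eq_le; apply/andP; split; last first.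
    by apply: le_outer_measure => y [By Ey]; split => //; apply: EH; split => //; exact: BW.
  have cB := ball_caratheodory hX x r.
  have := mH; rewrite (cB H) (cB (E `&` W)) => mHH.
  have le2 : mu (E `&` W `&` ~` ball x r) <= mu (H `&` ~` ball x r).
    by apply: le_outer_measure => y [] /EH.
  have f1 : mu (E `&` W `&` ball x r) \is a fin_num.
    rewrite ge0_fin_numE//; apply: le_lt_trans fEW.
    by apply: le_outer_measure => ? [].
  have f2 : mu (E `&` W `&` ~` ball x r) \is a fin_num.
    rewrite ge0_fin_numE//; apply: le_lt_trans fEW.
    by apply: le_outer_measure => ? [].
  apply: (@le_trans _ _ (mu (E `&` W `&` ball x r))); last first.
    by apply: le_outer_measure => y [[]].
  rewrite setIC -(leeD2rE _ _ f2) -mHH leeD2l//.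
apply: mu_eq0; apply/lee_addgt0Pr => e e0; rewrite add0e.
have eC0 : (0 < e * t / C)%R by rewrite divr_gt0// mulr_gt0.
have [U [F [oU cF FH HU mUF]]] := tight_borel cW fW bH eC0.
(* Balls inside U in which the complement of H takes at least the proportion t. *)
pose Fam := [set b : X * R | [/\ (0 < b.2 <= 1)%R, ball b.1 b.2 `<=` U `&` W &
   t%:E * mu (ball b.1 b.2) <= mu (ball b.1 b.2 `&` (W `\` H))]].
have := hC Fam (Z n k) (fun A => mu (A `&` (W `\` H))) t 1%R (e * t / C)%:E (ltW t0).
have -> : C%:E * (e * t / C)%:E = t%:E * e%:E.
  by rewrite -!EFinM mulrC divfK ?gt_eqF// mulrC.
move=> Hm.
rewrite -(@lee_pmul2l _ t%:E)//; apply: Hm => //.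
- by move=> b [].
- move=> x [Ex Wx Hx].
  have /nbhs_ballP[d /= d0 dUW] : nbhs x (U `&` W).
    apply: open_nbhs_nbhs; split; first by apply: openI => //; exact: open_metric_ball.
    by split => //; apply: HU; apply: EH.
  have [|r /andP[r0 rd] Hr] := Hx (Num.min d 1%R).
    by rewrite lt_min d0 ltr01.
  exists (x, r) => /=; last exact: ballxx.
  move: rd; rewrite lt_min => /andP[rd r1].
  have BUW : ball x r `<=` U `&` W by apply: subset_trans dUW; apply: le_ball; exact: ltW.
  split => //=; first by rewrite r0 ltW.
  rewrite (_ : _ `&` _ = ball x r `&` ~` H); last first.
    by apply/seteqP; split => y [By] => [[]//|nH]; split => //; split => //; case: (BUW _ By).
  have := bc _ bH (ball x r).
  rewrite traceH; last by move=> y /BUW[].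
  have := mu_ball_fin_num hX hdbl x r.
  have : mu (ball x r `&` E) <= mu (ball x r) by apply: le_outer_measure => ? [].
  have : mu (ball x r `&` ~` H) <= mu (ball x r) by apply: le_outer_measure => ? [].
  move: Hr; have := outer_measure_ge0 mu (ball x r `&` ~` H); have := outer_measure_ge0 mu (ball x r `&` E).
  case: (mu (ball x r)) => // m.
  case: (mu (ball x r `&` E)) => // a; case: (mu (ball x r `&` ~` H)) => // b.
  rewrite -!EFinM lte_fin !lee_fin -/t => _ _ H1 _ _ _ [H2]; rewrite H2 in H1 *; nra.
- by move=> b [].
- move=> s us sF sd; apply: le_trans (sum_disjoint_trace _ us _ _) _ => //.
    by move=> i; exact: ball_caratheodory.
  apply: le_trans mUF; apply: le_outer_measure => y [[b /= /sF[_ bUW _] By] [Wy nHy]].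
  by split => //; split; [case: (bUW _ By)|move=> /FH].
Qed.
End density.

(** * Functions made of countably many Lipschitz pieces *)

Section lipschitz_pieces.
Context {R : realType} {X : pmetricType R}.
Variable mu : {outer_measure set X -> \bar R}.
Hypothesis hX : metric_measure_space mu.
Hypothesis hdbl : doubling mu.
Implicit Types (x y z : X) (r s : R).

(** The extension is the infimum over y in E of g y + L d(x,y). *)
Lemma mcshane_extension (E : set X) (g : X -> R) (L : R) : 0 <= L ->
  (forall x y, E x -> E y -> `|g x - g y| <= L * mdist x y) ->
  exists2 F : X -> R^o, lipschitz_map F & forall x, E x -> F x = g x.
Proof.
move=> L0 gL.
have [[y0 Ey0]|E0] := pselect (E !=set0); last first.
  exists (fun=> 0); last by move=> x Ex; case: E0; exists x.
  by exists 0 => x y; rewrite subrr normr0 mul0r.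
pose S x := [set g y + L * mdist x y | y in E].
have S0 x : S x !=set0 by exists (g y0 + L * mdist x y0), y0.
have lbS x : lbound (S x) (g y0 - L * mdist x y0).
  move=> _ [y Ey <-]; have := gL _ _ Ey0 Ey; have := metric_triangle y0 x y.
  rewrite (metric_sym y0 x) ler_norml => t /andP[_ H].
  by have := ler_wpM2l L0 t; rewrite mulrDr; lra.
have hlS x : has_lbound (S x) by exists (g y0 - L * mdist x y0).
pose F x := inf (S x).
have half x y : F x - F y <= L * mdist x y.
  rewrite lerBlDl -lerBlDr; apply: lb_le_inf; first exact: S0.
  move=> _ [z Ez <-]; rewrite lerBlDr.
  apply: (@le_trans _ _ (g z + L * mdist x z)); first by apply: ge_inf => //; exists z.
  have := ler_wpM2l L0 (metric_triangle x y z); rewrite mulrDr; lra.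
exists F.
  exists L => x y; rewrite ler_norml half lerNl opprB andbT.
  by rewrite metric_sym half.
move=> x Ex; apply/eqP; rewrite eq_le; apply/andP; split.
  by apply: ge_inf => //; exists x => //; rewrite mdistxx mulr0 addr0.
apply: lb_le_inf => // _ [y Ey <-].
by have := gL _ _ Ex Ey; rewrite ler_norml => /andP[_]; lra.
Qed.

(** A one-sided Lipschitz bound in both orders of the points is enough for
    superlevel sets to be open; this form avoids absolute values. *)
Lemma lipschitz_open_gt (f : X -> R) (L c : R) :
  (forall x y, f x - f y <= L * mdist x y) -> open [set x | c < f x].
Proof.
move=> fL; rewrite openE => x /= cx; rewrite /interior -nbhs_ballE.
pose K := `|L| + 1.
have K0 : 0 < K by rewrite /K; have := normr_ge0 L; lra.
exists ((f x - c) / K) => /=; first by rewrite divr_gt0// subr_gt0.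
move=> y; rewrite in_ball ltr_pdivlMr// => xy /=.
have := fL x y; have d0 := mdist_ge0 x y.
have : L * mdist x y <= mdist x y * K.
  by rewrite mulrC ler_wpM2l// /K; have := ler_norm L; lra.
lra.
Qed.

Lemma closed_point x : closed [set x].
Proof.
rewrite (_ : [set x] = ~` [set y | 0 < mdist x y]).
  apply: open_closedC; apply: (@lipschitz_open_gt _ 1) => y z.
  by rewrite mul1r; have := metric_triangle x z y; rewrite (metric_sym z y); lra.
apply/seteqP; split => [y -> /=|y /= /negP]; first by rewrite mdistxx ltxx.
by rewrite mdist_gt0 negbK => /eqP.
Qed.

(** Points are closed.  This is needed because the sets in the definition of
    approximate limits contain the centre, which may be an atom. *)
Lemma caratheodory_point x : mu.-caratheodory [set x].
Proof.
rewrite -(setCK [set x]); apply: caratheodory_measurable_setC.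
apply: open_caratheodory => //; apply: closed_openC; exact: closed_point.
Qed.

Lemma density_point_sub (A B : set X) x : A `<=` B ->
  density_point mu A x -> density_point mu B x.
Proof.
move=> AB /(density_pointP hX hdbl) H; apply/(density_pointP hX hdbl) => e e0.
have [d d0 Hd] := H e e0; exists d => // r rd.
apply: le_trans (Hd r rd) _; apply: le_outer_measure; exact: setIS.
Qed.

(** The measurable set A splits the trace of B on each ball, so the
    loss is at most the measure of the ball outside A. *)
Lemma density_point_setI (A B : set X) x : mu.-caratheodory A ->
  density_point mu A x -> density_point mu B x -> density_point mu (A `&` B) x.
Proof.
move=> cA /(density_pointP hX hdbl) HA /(density_pointP hX hdbl) HB.
apply/(density_pointP hX hdbl) => e e0.
have e20 : 0 < e / 2 by rewrite divr_gt0.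
have [d1 d10 H1] := HA _ e20; have [d2 d20 H2] := HB _ e20.
exists (Num.min d1 d2); first by rewrite lt_min d10.
move=> r; rewrite lt_min => /and3P[r0 rd1 rd2].
have {H1} := H1 r; rewrite r0 rd1 => /(_ isT).
have {H2} := H2 r; rewrite r0 rd2 => /(_ isT).
have := mu_ball_fin_num hX hdbl x r.
have h1 : (mu (ball x r `&` B) <= mu (ball x r `&` (A `&` B)) + mu (ball x r `&` ~` A))%E.
  rewrite (cA (ball x r `&` B)) leeD//; apply: le_outer_measure => y [[? ?] ?] //.
have h2 := cA (ball x r).
move: h1; rewrite {}h2.
have g0 := outer_measure_ge0 mu.
have [] := (g0 (ball x r `&` A), g0 (ball x r `&` ~` A)).
have [] := (g0 (ball x r `&` B), g0 (ball x r `&` (A `&` B))).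
move: (mu (ball x r `&` A)) (mu (ball x r `&` ~` A)) (mu (ball x r `&` B)) (mu (ball x r `&` (A `&` B))).
move=> [a| |] [b| |] [c| |] [d| |] //=; rewrite ?leey ?lee_fin // => c0 d0 a0 b0 h _ h1 h2.
nra.
Qed.

Lemma mu_bigcup_count0 (I : countType) (A : I -> set X) :
  (forall i, mu (A i) = 0%E) -> mu (\bigcup_i A i) = 0%E.
Proof.
move=> A0; apply: (@mu_sub0 _ _ _ _ (\bigcup_n (if unpickle n is Some i then A i else set0))).
  by move=> x [i _ Ai]; exists (pickle i) => //; rewrite pickleK.
by apply: mu_bigcup0 => n; case: unpickle => [i|]; rewrite ?A0 ?outer_measure0.
Qed.

Lemma le_mx_entry n (v : 'rV[R]_n) i : `|v 0 i| <= `|v|.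
Proof.
rewrite [leRHS]/Num.norm /= mx_normrE.
exact: (le_bigmax _ (fun ij : 'I_1 * 'I_n => `|v ij.1 ij.2|) (ord0, i)).
Qed.

Lemma dotrv_bound n (v w : 'rV[R]_n) : `|dotrv v w| <= (\sum_(i < n) `|v 0 i|) * `|w|.
Proof.
rewrite /dotrv mulr_suml; apply: le_trans (ler_norm_sum _ _ _) _.
by apply: ler_sum => i _; rewrite normrM ler_wpM2l// le_mx_entry.
Qed.

(** Apart from x, this is a superlevel set of a Lipschitz function, hence
    open. *)
Lemma approx_set_caratheodory (n : nat) (F : X -> R^o) (c : X -> 'rV[R]_n) (L : 'rV[R]_n) x e :
  lipschitz_map F -> lipschitz_map c -> 
  mu.-caratheodory [set y | y = x \/
    `|F y - F x - dotrv L (c y - c x)| < e * mdist x y].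
Proof.
move=> [LF hF] [Lc hc].
rewrite (_ : [set y | _] = [set x] `|` [set y | 0 < e * mdist x y - `|F y - F x - dotrv L (c y - c x)|]); last first.
  by apply/seteqP; split => y /= [->|]; rewrite ?subr_gt0; [left|right|left|right].
apply: caratheodory_measurable_setU; first exact: caratheodory_point.
apply: open_caratheodory => //.
pose M := \sum_(i < n) `|L 0 i|.
apply: (@lipschitz_open_gt _ (`|e| + LF + M * Lc)) => y z.
have e1 : e * mdist x y - e * mdist x z <= `|e| * mdist y z.
  rewrite -mulrBr; apply: le_trans (ler_norm _) _; rewrite normrM ler_wpM2l//.
  rewrite ler_norml; have := metric_triangle x y z; have := metric_triangle x z y.
  by rewrite (metric_sym z y); lra.
have e2 : `|F z - F x - dotrv L (c z - c x)| - `|F y - F x - dotrv L (c y - c x)|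
   <= `|F y - F z| + `|dotrv L (c y - c z)|.
  have -> : dotrv L (c y - c z) = dotrv L (c y - c x) - dotrv L (c z - c x).
    rewrite /dotrv -sumrB; apply: eq_bigr => i _; rewrite !mxE; ring.
  move: (dotrv L (c y - c x)) (dotrv L (c z - c x)) => a b.
  have -> : F z - F x - b = (F y - F x - a) + (- (F y - F z) + (a - b)) by ring.
  rewrite lerBlDl; apply: le_trans (ler_normD _ _) _; rewrite lerD2l.
  by apply: le_trans (ler_normD _ _) _; rewrite normrN.
have := hF y z; have := dotrv_bound L (c y - c z).
have := ler_wpM2l (_ : 0 <= M) (hc y z).
rewrite -/M; have -> : 0 <= M by apply: sumr_ge0.
move=> /(_ isT); rewrite !mulrDl -mulrA; lra.
Qed.

(** At a density point x of E n where the McShane extension F n is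
    approximately differentiable, f coincides with F n on a set of density one
    at x, so the differential of F n is one for f. *)
Lemma ae_approx_differentiable_lipschitz_pieces (S : chart_system X)
    (f : X -> \bar R) (I : countType) (E : I -> set X) :
  approx_differentiable_structure mu S ->
  mu (~` \bigcup_n E n) = 0%E ->
  (forall n, exists (g : X -> R) (L : R), [/\ 0 <= L,
     forall x, E n x -> f x = (g x)%:E &
     forall x y, E n x -> E n y -> `|g x - g y| <= L * mdist x y]) ->
  ae_approx_differentiable mu S f.
Proof.
move=> [hchart hcov _ hdiff] Enull HE.
have /choice[F HF] n : exists F : X -> R^o, lipschitz_map F /\ forall x, E n x -> f x = (F x)%:E.
  have [g [L [L0 fg gL]]] := HE n; have [F FL Fg] := mcshane_extension L0 gL.
  by exists F; split => // x Ex; rewrite Fg// fg.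
pose quot n (a : chart_index S) x (L : 'rV[R]_(chart_dim a)) (y : X) :=
  `|F n y - F n x - dotrv L (chart_map a y - chart_map a x)| / mdist x y.
pose Q n (a : chart_index S) x := chart_set a x -> exists L, approx_limit mu (quot n a x L) x 0.
have Q0 n a : mu (~` [set x | Q n a x]) = 0%E.
  have [d [_ _ /ae_null]] := hdiff _ (HF n).1 a.
  move=> d0 _; apply: mu_sub0 d0.
  by move=> x Qx /= dx; apply: Qx => /= /dx; exists (d x).
pose D n := E n `&` [set x | ~ density_point mu (E n) x].
apply/ae_null => //.
apply: (@mu_sub0 _ _ _ _ (~` (\bigcup_n E n) `|` ~` (\bigcup_(a : chart_index S) chart_set a) `|`
  \bigcup_n D n `|` \bigcup_n \bigcup_a ~` [set x | Q n a x])); last first.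
  apply: mu_setU0; last by apply: mu_bigcup_count0 => n; apply: mu_bigcup_count0.
  apply: mu_setU0; last by apply: mu_bigcup_count0 => n; exact: ae_density_point.
  exact: mu_setU0.
move=> x /= nx; apply: contrapT => Nx; apply: nx.
have [n _ Enx] : (\bigcup_n E n) x by apply: contrapT => ?; apply: Nx; do 3 left.
have cx : (\bigcup_(a : chart_index S) chart_set a) x.
  by apply: contrapT => ?; apply: Nx; do 2 left; right.
have Dx : density_point mu (E n) x.
  by apply: contrapT => ?; apply: Nx; left; right; exists n.
have Qx a : Q n a x.
  by apply: contrapT => ?; apply: Nx; right; exists n => //; exists a.
split; first by have [a _ ?] := cx; exists a.
move=> a /Qx[L HL]; split; first by rewrite (HF n).2.
exists L => e e0.
pose A := [set y | y = x \/
    `|F n y - F n x - dotrv L (chart_map a y - chart_map a x)| < e * mdist x y].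
have cA : mu.-caratheodory A.
  apply: approx_set_caratheodory; first exact: (HF n).1.
  by case: (hchart a).
apply: (@density_point_sub (A `&` E n)).
  move=> y [[->|Ay] Ey]; first by left.
  by right; rewrite !(HF n).2//= lte_fin.
apply: density_point_setI => //.
apply: density_point_sub (HL _ e0) => y /= [->|]; first by left.
have [->|xy] := eqVneq y x; first by left.
rewrite subr0 ger0_norm ?divr_ge0// ?mdist_ge0// ltr_pdivrMr ?mdist_gt0 1?eq_sym//.
by right.
Qed.
End lipschitz_pieces.

(** * Integrability in Lebesgue spaces and Hajlasz-Sobolev functions *)

Section function_classes.
Context {R : realType} {X : pmetricType R}.
Variable mu : {outer_measure set X -> \bar R}.
Hypothesis hX : metric_measure_space mu.
Hypothesis hdbl : doubling mu.
Local Open Scope ereal_scope.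
Local Notation XM := (caratheodory_type mu).

Lemma mu_setT_gt0 : 0 < mu setT.
Proof. by rewrite lt_neqAle outer_measure_ge0 andbT eq_sym; case: hX. Qed.

(** The norm for the exponent +oo is defined by cases on the measure of the
    whole space, which is positive here. *)
Lemma LnormyP (f : X -> \bar R) (M : \bar R) :
  ('N[cmeas mu]_+oo[f] <= M) <-> {ae cmeas mu, forall x, `|f x| <= M}.
Proof.
rewrite unlock/= ifT; last exact: mu_setT_gt0.
by split => [/ess_sup_inf.ess_supP|H] //; apply/ess_sup_inf.ess_supP.
Qed.

Lemma Lnormy_ae (f : X -> \bar R) : 'N[cmeas mu]_+oo[f] < +oo ->
  exists2 M : R, (0 <= M)%R & {ae cmeas mu, forall x, `|f x| <= M%:E}.
Proof.
rewrite unlock/= ifT; last exact: mu_setT_gt0.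
move=> H; set M := ess_sup_inf.ess_sup _ _ in H.
have M0 : 0 <= M.
  by apply: ess_sup_inf.ess_sup_gee; [exact: mu_setT_gt0|apply: aeW => x /=].
exists (fine M); first exact: fine_ge0.
rewrite fineK; last by rewrite ge0_fin_numE.
exact: (@ess_sup_inf.ess_sup_ge _ XM R (cmeas mu) (abse \o f)).
Qed.

Lemma Lnorm_integral_fin (p : R) (f : X -> \bar R) : (1 <= p)%R ->
  'N[cmeas mu]_p%:E[f] < +oo -> \int[cmeas mu]_x (`|f x| `^ p) < +oo.
Proof.
move=> p1 H; rewrite -poweR_Lnorm; last by rewrite gt_eqF// (lt_le_trans ltr01).
exact: poweR_lty.
Qed.

Lemma measurable_poweR_comp (p : R) (f : X -> \bar R) :
  mu_measurable_fun mu f -> mu_measurable_fun mu (fun x => f x `^ p).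
Proof. by move=> mf; apply: (measurableT_comp (measurable_poweR p)). Qed.

Lemma le_poweR_add1 (p : R) (a : \bar R) : (1 <= p)%R -> 0 <= a -> a <= 1 + a `^ p.
Proof.
move=> p1; case: a => [a| |//]; last first.
  by rewrite poweRyr ?addey// gt_eqF// (lt_le_trans ltr01).
rewrite lee_fin => a0; rewrite poweR_EFin -EFinD lee_fin.
have [a1|a1] := leP a 1%R; first by apply: le_trans a1 _; rewrite lerDl powR_ge0.
apply: (@le_trans _ _ (a `^ p)%R); last by rewrite lerDr.
by rewrite -{1}(powRr1 a0) ler_powR// ltW.
Qed.

(** For finite p the bound is |f| <= 1 + |f|^p. *)
Lemma Lp_locally_integrable (p : \bar R) (f : X -> \bar R) (A : set X) : 1 <= p ->
  in_Lp mu p f -> mu.-caratheodory A -> mu A < +oo ->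
  (cmeas mu).-integrable (A : set XM) f.
Proof.
move=> p1 [mf Nf] cA fA; apply/integrableP; split; first exact: measurable_funTS.
case: p p1 Nf => [p| |//].
- rewrite lee_fin => p1 /(Lnorm_integral_fin p1) H.
  apply: (@le_lt_trans _ _ (\int[cmeas mu]_(x in A) (1 + `|f x| `^ p))).
    apply: ge0_le_integral => //.
    + by apply: measurable_funTS; exact: measurableT_comp.
    + apply: measurable_funTS; apply: emeasurable_funD => //.
      by apply: measurable_poweR_comp; exact: measurableT_comp.
    + by move=> x _; apply: le_poweR_add1.
  rewrite ge0_integralD//=; last 2 first.
    + by move=> x _; rewrite poweR_ge0.
    + by apply: measurable_funTS; apply: measurable_poweR_comp; exact: measurableT_comp.
  rewrite integral_cst// mul1e lte_add_pinfty//.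
  apply: le_lt_trans H; apply: ge0_subset_integral => //.
  + by apply: measurable_poweR_comp; exact: measurableT_comp.
  + by move=> x _; rewrite poweR_ge0.
- move=> _ /Lnormy_ae[M M0 HM].
  apply: le_lt_trans (_ : M%:E * mu A < +oo); last by rewrite lte_mul_pinfty.
  apply: (@integral_le_bound _ XM R (cmeas mu) A f M%:E) => //.
  + exact: measurable_funTS.
  + by move/ae_null : HM => HM; apply/ae_null; apply: mu_sub0 HM => x /= nx Mx; apply: nx.
Qed.

Lemma Lp_ae_fin (p : \bar R) (f : X -> \bar R) : 1 <= p -> in_Lp mu p f ->
  mu [set x | f x \isn't a fin_num] = 0.
Proof.
move=> p1 fLp.
pose W n : set X := ball point (2 ^+ n * 1 : R)%R.
apply: (@mu_sub0 _ _ _ _ (\bigcup_n (W n `&` [set x | f x \isn't a fin_num]))).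
  move=> x fx; have [n Hn] := @ball_exhaust _ _ point x 1 1 ltr01.
  by exists n => //; split => //; apply: Hn; exact: ballxx.
apply: mu_bigcup0 => n.
have cW := ball_caratheodory hX point (2 ^+ n * 1 : R)%R.
have := @integrable_ae _ XM R (cmeas mu) _ cW _ (Lp_locally_integrable p1 fLp cW (mu_ball_fin hX hdbl _ _)).
move=> /ae_null; apply: mu_sub0 => x [Wx /= fx] /= H.
by move: fx; rewrite (H Wx).
Qed.

(** The Lipschitz pieces are the sets where the Hajlasz gradient g is at most
    n; they exhaust the space because g is finite almost everywhere. *)
Lemma hajlasz_sobolev_approx_differentiable (S : chart_system X) p (f : X -> \bar R) :
  1 <= p -> approx_differentiable_structure mu S ->
  hajlasz_sobolev mu p f -> ae_approx_differentiable mu S f.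
Proof.
move=> p1 hS [_ [g [g0 gLp [N N0 fg]]]].
have gfin := Lp_ae_fin p1 gLp.
apply: (@ae_approx_differentiable_lipschitz_pieces _ _ _ hX hdbl S f nat
   (fun n => [set x | ~ N x /\ (g x <= n%:R%:E)%E])) => //.
  apply: (@mu_sub0 _ _ _ _ (N `|` [set x | g x \isn't a fin_num])) => //; last first.
    exact: mu_setU0.
  move=> x Hx; apply: contrapT => /not_orP[Nx /negP/negPn gx]; apply: Hx.
  exists (Num.truncn (fine (g x))).+1 => //=; split => //.
  by rewrite -(fineK gx) lee_fin ltW// truncnS_gt.
move=> n; exists (fine \o f), (2 * n%:R)%R.
have gf x : g x <= n%:R%:E -> g x \is a fin_num.
  move=> gx; rewrite ge0_fin_numE ?(ltW (g0 x))//; apply: le_lt_trans gx _; exact: ltry.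
have ff x : ~ N x -> g x <= n%:R%:E -> f x \is a fin_num.
  (* The inequality at the pair (x, x) forces f x to be finite, as the difference of two equal infinities has infinite absolute value. *)
  move=> Nx gx; have := fg x x Nx Nx; rewrite mdistxx mul0e; case: (f x) => //=.
split.
- by rewrite mulr_ge0.
- by move=> x [Nx gx] /=; rewrite fineK// ff.
- move=> x y [Nx gx] [Ny gy] /=; have := fg x y Nx Ny.
  rewrite -(fineK (ff _ Nx gx)) -(fineK (ff _ Ny gy)) -EFinB/= => H.
  rewrite -lee_fin; apply: le_trans H _.
  rewrite [leRHS](_ : _ = (mdist x y)%:E * (n%:R%:E + n%:R%:E)); last first.
    by rewrite -EFinD -EFinM; congr EFin; ring.
  by apply: lee_wpmul2l; [rewrite lee_fin mdist_ge0|exact: leeD].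
Qed.
End function_classes.

(** * Functions with small mean oscillation *)

Section mean_oscillation.
Context {R : realType} {X : pmetricType R}.
Variable mu : {outer_measure set X -> \bar R}.
Hypothesis hX : metric_measure_space mu.
Hypothesis hdbl : doubling mu.
Local Open Scope ereal_scope.
Local Notation XM := (caratheodory_type mu).

Lemma avg_fin_num (f : X -> \bar R) (A : set X) : mu.-caratheodory A ->
  (cmeas mu).-integrable (A : set XM) f -> avg mu A f \is a fin_num.
Proof.
by move=> cA fi; rewrite /avg fin_numM// (@integrable_fin_num _ XM).
Qed.

Lemma integrable_cst_finite (A : set X) (c : R) :
  mu.-caratheodory A -> mu A < +oo -> (cmeas mu).-integrable (A : set XM) (fun=> c%:E).
Proof.
move=> cA fA; apply/integrableP; split; first exact: measurable_cst.
rewrite (_ : \int[_]_(x in _) _ = `|c%:E| * mu A); first by rewrite lte_mul_pinfty.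
exact: (@integral_cst _ XM _ (cmeas mu) A cA `|c%:E|).
Qed.

Lemma integrable_sub_cst (f : X -> \bar R) (A : set X) (c : R) :
  mu.-caratheodory A -> mu A < +oo -> (cmeas mu).-integrable (A : set XM) f ->
  (cmeas mu).-integrable (A : set XM) (fun y => f y - c%:E).
Proof.
move=> cA fA fi; apply: (@integrableB _ XM) => //.
exact: integrable_cst_finite.
Qed.

(** Jensen's inequality on A, followed by enlarging A to B. *)
Lemma avg_sub_cst (f : X -> \bar R) (A B : set X) (c s : R) :
  mu.-caratheodory A -> mu.-caratheodory B -> A `<=` B -> 0 < mu A -> mu B < +oo ->
  (cmeas mu).-integrable (B : set XM) f ->
  \int[cmeas mu]_(y in B) `|f y - c%:E| <= s%:E ->
  (`|fine (avg mu A f) - c| <= s / fine (mu A))%R.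
Proof.
move=> cA cB AB A0 fB fi Hs.
have fA : mu A < +oo by apply: le_lt_trans fB; exact: le_outer_measure.
have fiA : (cmeas mu).-integrable (A : set XM) f by exact: (@integrableS _ XM R (cmeas mu) B).
have mA0 : (0 < fine (mu A))%R by rewrite fine_gt0// A0.
have iA := integrable_sub_cst c cA fA fiA.
have iB := integrable_sub_cst c cB fB fi.
have H : `|\int[cmeas mu]_(y in A) f y - c%:E * mu A| <= s%:E.
  rewrite -(@integral_cst _ XM _ (cmeas mu) A cA c%:E) -(@integralB _ XM)//; last first.
    exact: integrable_cst_finite.
  apply: le_trans (@le_abse_integral _ XM _ (cmeas mu) A _ cA _) _.
    exact: (measurable_int (cmeas mu)).
  apply: le_trans Hs; apply: (@ge0_subset_integral _ XM _ (cmeas mu)) => //.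
  by apply: measurableT_comp => //; exact: (measurable_int (cmeas mu) iB).
have fI := @integrable_fin_num _ XM _ (cmeas mu) _ cA _ fiA.
move: H; rewrite -{1}(fineK fI) -{1}(@fineK _ (mu A)) ?ge0_fin_numE//.
rewrite -EFinM -EFinB/= lee_fin => H.
rewrite ler_pdivlMr// /avg -(fineK fI)/= -[X in (_ * X)%R](gtr0_norm mA0) -normrM.
by rewrite mulrBl mulrAC mulVf ?gt_eqF// mul1r.
Qed.

(** Approximate continuity includes finiteness of the value, so that the
    differences are meaningful. *)
Definition approx_continuous_at (f : X -> \bar R) (x : X) := f x \is a fin_num /\
  forall e : R, (0 < e)%R -> density_point mu [set y | `|f y - f x| < e%:E] x.

(** It suffices to consider density points of the countably many sets
    f^-1(]q1, q2[) with q1 and q2 rational. *)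
Lemma ae_approx_continuous (f : X -> \bar R) :
  mu [set x | f x \isn't a fin_num] = 0 ->
  mu (~` [set x | approx_continuous_at f x]) = 0.
Proof.
move=> ff.
pose A (q : rat * rat) := [set y | (ratr q.1)%:E < f y < (ratr q.2)%:E].
pose D q := A q `&` [set x | ~ density_point mu (A q) x].
apply: (@mu_sub0 _ _ _ _ ([set x | f x \isn't a fin_num] `|` \bigcup_q D q)); last first.
  by apply: mu_setU0 => //; apply: mu_bigcup_count0 => q; exact: ae_density_point.
move=> x nx; apply: contrapT => /not_orP[/negP/negPn fx nD]; apply: nx.
split => // e e0.
have lt1 : (fine (f x) - e < fine (f x))%R by rewrite ltrBlDr ltrDl.
have lt2 : (fine (f x) < fine (f x) + e)%R by rewrite ltrDl.
have [q1] := rat_in_itvoo lt1; have [q2] := rat_in_itvoo lt2.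
rewrite !in_itv/= => /andP[q2l q2r] /andP[q1l q1r].
apply: (@density_point_sub _ _ _ hX hdbl (A (q1, q2))).
  move=> y /= /andP[]; rewrite -(fineK fx); case: (f y) => [v| |] //=.
  rewrite !lte_fin => ? ?; rewrite ltr_norml.
  by apply/andP; split; lra.
apply: contrapT => nd; apply: nD; exists (q1, q2) => //; split => //=.
by rewrite /A /= -(fineK fx) !lte_fin q1r.
Qed.

Variable f : X -> \bar R.
Hypothesis intf : forall x r, (cmeas mu).-integrable (ball x r : set XM) f.

Let m x r := fine (avg mu (ball x r) f).

(** A single index k serves as slope and, through k+1, as inverse scale, so
    that the points of small oscillation are exhausted by countably many
    sets. *)
Definition small_oscillation (k : nat) (x : X) := forall r, (0 < r)%R -> (r * k.+1%:R < 1)%R ->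
  avg mu (ball x r) (fun y => `|f y - avg mu (ball x r) f|) <= (k%:R * r)%:E.

Lemma small_oscillation_int k x r : small_oscillation k x -> (0 < r)%R -> (r * k.+1%:R < 1)%R ->
  \int[cmeas mu]_(y in ball x r) `|f y - (m x r)%:E| <= (k%:R * r * fine (mu (ball x r)))%:E.
Proof.
move=> Hk r0 rk; have := Hk r r0 rk.
have cB := ball_caratheodory hX x r.
have mB0 : (0 < fine (mu (ball x r)))%R.
  by rewrite fine_gt0// mu_ball_gt0//= mu_ball_fin.
rewrite {1}/avg -(fineK (avg_fin_num cB (intf x r))) -/(m x r).
by rewrite muleC lee_pdivrMr// -EFinM.
Qed.

(** Comparison of the means over a ball and over a smaller one of comparable
    measure. *)
Lemma mean_sub_mean (C : R) k x r y s : small_oscillation k x ->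
  (0 < r)%R -> (r * k.+1%:R < 1)%R -> (0 < s)%R -> ball y s `<=` ball x r ->
  mu (ball x r) <= C%:E * mu (ball y s) ->
  (`|m y s - m x r| <= C * (k%:R * r))%R.
Proof.
move=> Hk r0 rk s0 BB CB.
have mB0 : (0 < fine (mu (ball y s)))%R.
  by rewrite fine_gt0// mu_ball_gt0//= mu_ball_fin.
apply: le_trans (avg_sub_cst _ _ BB _ _ _ (small_oscillation_int Hk r0 rk)) _.
- exact: ball_caratheodory.
- exact: ball_caratheodory.
- exact: mu_ball_gt0.
- exact: mu_ball_fin.
- exact: intf.
rewrite ler_pdivrMr//.
move: CB; rewrite -(fineK (mu_ball_fin_num hX hdbl x r)) -(fineK (mu_ball_fin_num hX hdbl y s)) -EFinM lee_fin.
have kr0 : (0 <= k%:R * r)%R by rewrite mulr_ge0// ltW.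
by move=> /(ler_wpM2l kr0) /le_trans; apply; rewrite mulrCA mulrA.
Qed.

(** The means converge to the approximate limit.  Otherwise f would differ
    from its mean by e/2 on at least half of a small ball, while by Chebyshev's
    inequality the measure of that part is at most 2 k r / e times that of the
    ball. *)
Lemma mean_near_value k x e : approx_continuous_at f x -> small_oscillation k x ->
  (0 < e)%R -> exists2 d, (0 < d)%R & forall r, (0 < r < d)%R -> (`|m x r - fine (f x)| <= e)%R.
Proof.
move=> [fx acx] Hk e0.
have e20 : (0 < e / 2)%R by rewrite divr_gt0.
have /(density_pointP hX hdbl)/(_ _ (divr_gt0 ltr01 (@ltr0n R 2)))[d d0 Hd] := acx _ e20.
pose K : R := (4 * k.+1%:R / e + k.+1%:R)%R.
have K0 : (0 < K)%R by rewrite addr_gt0// ?divr_gt0// mulr_gt0.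
exists (Num.min d (K^-1)%R); first by rewrite lt_min d0 invr_gt0.
move=> r; rewrite lt_min => /and3P[r0 rd rK].
rewrite leNgt; apply/negP => He.
have {}rK : (r * K < 1)%R by rewrite -ltr_pdivlMr// div1r.
have rk : (r * k.+1%:R < 1)%R.
  apply: le_lt_trans rK; rewrite ler_pM2l// lerDr divr_ge0// ?(ltW e0)// mulr_ge0//.
have := small_oscillation_int Hk r0 rk; have := Hd r; rewrite r0 rd => /(_ isT).
have cB := ball_caratheodory hX x r.
have iB := integrable_sub_cst (m x r) cB (mu_ball_fin hX hdbl x r) (intf x r).
have := @le_integral_abse _ XM _ (cmeas mu) _ cB _ _ (measurable_int (cmeas mu) iB) e20.
have sub : ball x r `&` [set y | `|f y - f x| < (e / 2)%:E] `<=`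
   ball x r `&` [set y | (e / 2)%:E <= `|f y - (m x r)%:E|].
  move=> y [By /= Hy]; split => //=; move: Hy; rewrite -(fineK fx).
  case: (f y) => [v| |] //=; rewrite lte_fin lee_fin.
  move=> H; have := ler_normD (m x r - v)%R (v - fine (f x))%R.
  rewrite subrKA (distrC (m x r) v); lra.
have /le_outer_measure le1 := sub => H1 H2 H3.
have H4 := le_trans H2 (le1 _ mu).
have e2 : 0 <= (e / 2)%:E by rewrite lee_fin ltW.
have mB0 : (0 < fine (mu (ball x r)))%R.
  by rewrite fine_gt0// mu_ball_gt0//= mu_ball_fin.
have := le_trans (lee_wpmul2l e2 H4) (le_trans H1 H3).
rewrite -(fineK (mu_ball_fin_num hX hdbl x r)) -!EFinM lee_fin mulrA ler_pM2r//.
move: rK; rewrite /K mulrDr => rK H.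
have : (r * (4 * k.+1%:R / e) < 1)%R by apply: le_lt_trans rK; rewrite lerDl mulr_ge0// ltW.
rewrite mulrA ltr_pdivrMr// mul1r -natr1; have : (0 <= k%:R * r)%R by rewrite mulr_ge0// ltW.
nra.
Qed.

(** Telescoping over the radii r / 2^n: the successive differences form a
    geometric series. *)
Lemma value_sub_mean C k x : (0 <= C)%R -> (forall z r, (0 < r)%R ->
    mu (ball z (2 * r)%R) <= C%:E * mu (ball z r)) ->
  approx_continuous_at f x -> small_oscillation k x -> forall r,
  (0 < r)%R -> (r * k.+1%:R < 1)%R -> (`|fine (f x) - m x r| <= 2 * C * (k%:R * r))%R.
Proof.
move=> C0 hC acx Hk r r0 rk.
pose rn n := (r / 2 ^+ n)%R.
have rn0 n : (0 < rn n)%R by rewrite divr_gt0// exprn_gt0.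
have rnr n : (rn n <= r)%R by rewrite ler_pdivrMr ?exprn_gt0// ler_peMr ?(ltW r0)// exprn_ege1// ler1n.
(* The factor 1 - 2^-n is the partial sum of the geometric series. *)
have step n : (`|m x (rn n) - m x r| <= 2 * C * (k%:R * r) * (1 - (2 ^+ n)^-1))%R.
  elim: n => [|n IH]; first by rewrite /rn expr0 divr1 !subrr normr0 invr1 subrr mulr0.
  have -> : (m x (rn n.+1) - m x r = (m x (rn n.+1) - m x (rn n)) + (m x (rn n) - m x r))%R by ring.
  apply: le_trans (ler_normD _ _) _.
  have rn2 : (rn n = 2 * rn n.+1)%R.
    by rewrite /rn exprS invfM; field; rewrite expf_neq0.
  have := @mean_sub_mean C k x (rn n) x (rn n.+1) Hk (rn0 n) _ (rn0 n.+1).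
  rewrite {1 3 4}rn2 => /(_ _ _ (hC _ _ (rn0 n.+1))) H.
  have {H} : (`|m x (rn n.+1) - m x (2 * rn n.+1)| <= C * (k%:R * rn n))%R.
    apply: H.
      by rewrite -rn2; apply: le_lt_trans rk; rewrite ler_pM2r.
    by apply: le_ball; rewrite rn2 ler_peMl ?ler1n// ltW.
  rewrite -rn2 => H; apply: le_trans (lerD H IH) _.
  rewrite /rn exprS invfM le_eqVlt; apply/orP; left; apply/eqP; field; rewrite expf_neq0//.
apply/ler_addgt0Pr => e e0.
have [d d0 Hd] := mean_near_value acx Hk e0.
have [n Hn] : exists n, (rn n < d)%R.
  exists (Num.truncn (r / d)).+1; rewrite ltr_pdivrMr ?exprn_gt0// mulrC -ltr_pdivrMr//.
  apply: lt_le_trans (truncnS_gt _) _.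
  by rewrite -natrX ler_nat ltnW// ltn_expl.
have := Hd (rn n); rewrite rn0 Hn => /(_ isT) H1.
have -> : (fine (f x) - m x r = (fine (f x) - m x (rn n)) + (m x (rn n) - m x r))%R by ring.
apply: le_trans (ler_normD _ _) _; rewrite addrC lerD//; last by rewrite distrC.
apply: le_trans (step n) _; by rewrite ler_piMr ?mulr_ge0// ?(ltW r0)// gerBl invr_ge0 exprn_ge0.
Qed.

(** Chain the value at x, the mean over B(x, 2 r), the mean over B(y, r) and
    the value at y, where r is the distance of x and y. *)
Lemma small_oscillation_lipschitz : exists2 C : R, (0 < C)%R & forall k x y,
  approx_continuous_at f x -> small_oscillation k x ->
  approx_continuous_at f y -> small_oscillation k y ->
  (2 * mdist x y * k.+1%:R < 1)%R ->
  (`|fine (f x) - fine (f y)| <= C * k%:R * mdist x y)%R.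
Proof.
have [C C0 hC] := hdbl.
exists (2 * C ^+ 2 + 6 * C)%R; first by rewrite addr_gt0// mulr_gt0// exprn_gt0.
move=> k x y acx Hx acy Hy dk.
have [->|xy] := eqVneq x y; first by rewrite subrr normr0 mdistxx mulr0.
have r0 : (0 < mdist x y)%R by rewrite mdist_gt0.
pose r := mdist x y; rewrite -/r in r0 dk *.
have r20 : (0 < 2 * r)%R by rewrite mulr_gt0.
have rk : (r * k.+1%:R < 1)%R.
  by apply: le_lt_trans dk; rewrite ler_pM2r// ler_peMl ?ler1n// ltW.
have h1 := value_sub_mean (ltW C0) hC acx Hx r20 dk.
have h2 := value_sub_mean (ltW C0) hC acy Hy r0 rk.
have h3 : (`|m y r - m x (2 * r)| <= C ^+ 2 * (k%:R * (2 * r)))%R.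
  apply: mean_sub_mean => //.
    by move=> z; rewrite !in_ball => yz; have := metric_triangle x y z; rewrite -/r; lra.
  apply: (@le_trans _ _ (mu (ball y (2 * (2 * r))))).
    apply: le_outer_measure => z; rewrite !in_ball => xz.
    by have := metric_triangle y x z; rewrite (metric_sym y x) -/r; lra.
  apply: le_trans (hC _ _ r20) _; rewrite expr2 EFinM -muleA lee_wpmul2l ?lee_fin ?(ltW C0)//.
  exact: hC.
have -> : (fine (f x) - fine (f y) = (fine (f x) - m x (2 * r)) - (m y r - m x (2 * r)) - (fine (f y) - m y r))%R by ring.
apply: le_trans (ler_normB _ _) _; apply: le_trans (lerD (ler_normB _ _) (lexx _)) _.
apply: le_trans (lerD (lerD h1 h3) h2) _.
by rewrite le_eqVlt; apply/orP; left; apply/eqP; ring.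
Qed.

(** The Lipschitz estimate holds only for points at distance below a scale
    that depends on k, so the set with index k is further cut by countably many
    small balls. *)
Lemma approx_differentiable_small_oscillation (S : chart_system X) :
  approx_differentiable_structure mu S ->
  mu [set x | f x \isn't a fin_num] = 0 ->
  mu (~` [set x | exists k, small_oscillation k x]) = 0 ->
  ae_approx_differentiable mu S f.
Proof.
move=> hS ff osc0.
have [C C0 HC] := small_oscillation_lipschitz.
have sep : @separable_space R X by case: hX.
have rk0 k : (0 < ((8 * k.+1%:R)^-1 : R))%R by rewrite invr_gt0 mulr_gt0.
have /choice[c Hc] k := separable_lindelof_small sep (rk0 k).
pose E (kn : nat * nat) := [set x | [/\ approx_continuous_at f x,
  small_oscillation kn.1 x & ball (c kn.1 kn.2) ((8 * kn.1.+1%:R)^-1)%R x]].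
apply: (@ae_approx_differentiable_lipschitz_pieces _ _ _ hX hdbl S f _ E) => //.
  apply: (@mu_sub0 _ _ _ _ (~` [set x | approx_continuous_at f x] `|`
     ~` [set x | exists k, small_oscillation k x])); last first.
    by apply: mu_setU0 => //; exact: ae_approx_continuous.
  move=> x nx; apply: contrapT => /not_orP[/contrapT acx /contrapT [k Hk]]; apply: nx.
  by have [n xn] := Hc k x; exists (k, n).
move=> [k n]; exists (fine \o f), (C * k%:R)%R; split.
- by rewrite mulr_ge0// ltW.
- by move=> x [[fx _] _ _] /=; rewrite fineK.
- move=> x y [acx Hx /=]; rewrite in_ball => cx [acy Hy /=]; rewrite in_ball => cy.
  apply: HC => //.
  have := metric_triangle x (c k n) y; rewrite (metric_sym x (c k n)) => t.
  have k0 : (0 < k.+1%:R :> R)%R by [].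
  have wk : ((8 * k.+1%:R)^-1 * (8 * k.+1%:R) = 1 :> R)%R by rewrite mulVf ?gt_eqF// mulr_gt0.
  move: cx cy wk t; move: (8 * k.+1%:R)^-1%R => w cx cy wk t.
  have : (mdist x y * k.+1%:R < 2 * w * k.+1%:R)%R by rewrite ltr_pM2r//; lra.
  lra.
Qed.
End mean_oscillation.

(** * Arc-length parametrization of rectifiable curves *)

Section arc_length_parametrization.
Context {R : realType} {X : pmetricType R}.
Implicit Types (g : R -> X) (a b c u v w : R) (s : seq R).

(** Length of the polygonal chain through the parameters a :: s, by recursion
    on s; arc length is its supremum. *)
Fixpoint chain_length g a s : R :=
  if s is x :: s' then mdist (g a) (g x) + chain_length g x s' else 0.

Lemma chain_length_ge0 g a s : 0 <= chain_length g a s.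
Proof. by elim: s a => //= x s IH a; rewrite addr_ge0// mdist_ge0. Qed.

Lemma chain_length_sum g a b s :
  \sum_(0 <= n < size s) mdist (g (nth b (a :: s) n)) (g (nth b (a :: s) n.+1))
  = chain_length g a s.
Proof.
elim: s a => [|x s IH] a /=; first by rewrite big_geq.
by rewrite big_nat_recl//= IH.
Qed.

Lemma chain_length_cat g a s1 s2 :
  chain_length g a (s1 ++ s2) = chain_length g a s1 + chain_length g (last a s1) s2.
Proof. by elim: s1 a => [|x s IH] a /=; rewrite ?add0r// IH addrA. Qed.

Lemma arc_lengthE g a b : arc_length g a b =
  ereal_sup [set (chain_length g a s)%:E | s in [set s | path.path <%R a s /\ last a s = b]].
Proof.
congr ereal_sup; apply/seteqP; split => _ [s sab <-]; exists s => //; rewrite ?chain_length_sum//.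
- by case: sab => ? /eqP.
- by case: sab => ? ?; split => //; apply/eqP.
Qed.

Lemma chain_le_arc_length g a s : path.path <%R a s ->
  ((chain_length g a s)%:E <= arc_length g a (last a s))%E.
Proof. by move=> ps; rewrite arc_lengthE; apply: ereal_sup_ubound; exists s. Qed.

Lemma mdist_le_arc_length g a b : a <= b -> ((mdist (g a) (g b))%:E <= arc_length g a b)%E.
Proof.
rewrite le_eqVlt => /predU1P[->|ab].
  by rewrite mdistxx; exact: (@chain_le_arc_length g b [::]).
by have := @chain_le_arc_length g a [:: b]; rewrite /= ab addr0 => /(_ isT).
Qed.

Lemma arc_length_ge0 g a b : a <= b -> (0 <= arc_length g a b)%E.
Proof. by move=> ab; apply: le_trans (mdist_le_arc_length g ab); rewrite lee_fin mdist_ge0. Qed.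

(** Inserting the point c into a subdivision does not decrease the length of
    the chain, by the triangle inequality. *)
Lemma chain_split g c s a : path.path <%R a s -> a <= c <= last a s ->
  exists s1 s2, [/\ path.path <%R a s1, last a s1 = c, path.path <%R c s2,
    last c s2 = last a s &
    chain_length g a s <= chain_length g a s1 + chain_length g c s2].
Proof.
elim: s a => [|x s IH] a /=.
  move=> _ /le_anti <-; exists [::], [::]; split => //=; by rewrite addr0.
move=> /andP[ax ps] /andP[ac cl].
have [xc|cx] := leP x c.
  have [|s1 [s2 [p1 l1 p2 l2 H]]] := IH x ps; first by rewrite xc.
  by exists (x :: s1), s2; split => //=; rewrite ?ax// -addrA lerD2l.
have [<-|ac'] := eqVneq a c.
  by exists [::], (x :: s); split => //=; rewrite ?ax// add0r.
exists [:: c], (x :: s); split => //=.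
- by rewrite lt_neqAle ac' ac.
- by rewrite cx.
- by rewrite addr0 addrA lerD2r metric_triangle.
Qed.

Lemma arc_lengthD g a c b : a <= c -> c <= b ->
  arc_length g a b = (arc_length g a c + arc_length g c b)%E.
Proof.
move=> ac cb; apply/eqP; rewrite eq_le; apply/andP; split.
  rewrite {1}arc_lengthE; apply: ge_ereal_sup => _ [s [ps ls] <-].
  have [|s1 [s2 [p1 l1 p2 l2 H]]] := @chain_split g c s a ps; first by rewrite ac ls.
  apply: (@le_trans _ _ (chain_length g a s1 + chain_length g c s2)%:E).
    by rewrite lee_fin.
  rewrite EFinD; apply: leeD.
    by rewrite -l1; exact: chain_le_arc_length.
  by rewrite -ls -l2; exact: chain_le_arc_length.
have [H|] := eqVneq (arc_length g a b) +oo%E; first by rewrite H leey.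
rewrite -ltey => fin.
have cat s1 s2 : path.path <%R a s1 -> last a s1 = c -> path.path <%R c s2 -> last c s2 = b ->
  ((chain_length g a s1)%:E + (chain_length g c s2)%:E <= arc_length g a b)%E.
  move=> p1 l1 p2 l2.
  have := @chain_le_arc_length g a (s1 ++ s2).
  by rewrite cat_path p1 l1 p2 last_cat l1 l2 chain_length_cat l1 => /(_ isT).
have step s1 : path.path <%R a s1 -> last a s1 = c ->
    ((chain_length g a s1)%:E + arc_length g c b <= arc_length g a b)%E.
  move=> p1 l1; rewrite addeC -leeBrDr//; rewrite [leLHS]arc_lengthE.
  apply: ge_ereal_sup => _ [s2 [p2 l2] <-]; rewrite leeBrDr// addeC.
  exact: cat.
have fcb : (arc_length g c b < +oo)%E.
  have [s1 [p1 l1]] : exists s1, path.path <%R a s1 /\ last a s1 = c.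
    move: ac; rewrite le_eqVlt => /predU1P[->|ac]; first by exists [::].
    by exists [:: c]; rewrite /= ac.
  apply: le_lt_trans fin; apply: le_trans (step _ p1 l1).
  by rewrite leeDr// lee_fin chain_length_ge0.
have fcb' : arc_length g c b \is a fin_num by rewrite ge0_fin_numE// arc_length_ge0.
rewrite -leeBrDr// [leLHS]arc_lengthE.
by apply: ge_ereal_sup => _ [s1 [p1 l1] <-]; rewrite leeBrDr//; exact: step.
Qed.

(** A subdivision loses little when its first point is replaced by a nearby w:
    its length is at most the jump from g a to g w plus the remaining
    arc length.  With a near-optimal subdivision and the continuity of g this
    says that arc length does not jump to the right of a. *)
Lemma chain_head g a b s : a < b -> path.path <%R a s -> last a s = b ->
  exists2 v, a < v <= b & forall w, a < w -> w <= v ->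
    ((chain_length g a s)%:E <= (mdist (g a) (g w))%:E + arc_length g w b)%E.
Proof.
case: s => [|v s] /= ab; first by move=> _ ba; rewrite ba ltxx in ab.
move=> /andP[av ps] ls.
have vb : v <= b.
  by rewrite -ls; elim: s v ps {av ls} => //= x s IH v /andP[/ltW vx /IH]; exact: le_trans.
exists v; first by rewrite av.
move=> w aw wv; rewrite EFinD.
apply: (@le_trans _ _ ((mdist (g a) (g w))%:E + (mdist (g w) (g v))%:E + (chain_length g v s)%:E)%E).
  by rewrite leeD2r// -EFinD lee_fin metric_triangle.
rewrite -addeA leeD2l// (arc_lengthD g wv vb) leeD//; first exact: mdist_le_arc_length.
by rewrite -ls; exact: chain_le_arc_length.
Qed.

(** The mirror image of the previous estimate, for continuity of arc length
    from the left. *)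
Lemma chain_tail g a b s : a < b -> path.path <%R a s -> last a s = b ->
  exists2 v, a <= v < b & forall w, v <= w -> w < b ->
    ((chain_length g a s)%:E <= arc_length g a w + (mdist (g w) (g b))%:E)%E.
Proof.
case/lastP: s => [|s b'] ab; first by move=> _ /= ba; rewrite ba ltxx in ab.
rewrite rcons_path last_rcons => /andP[ps vb] bb'; rewrite {b'}bb' in vb *.
set v := last a s in vb.
have av : a <= v.
  by rewrite /v; elim: s a ps {ab vb v} => //= x s IH a /andP[/ltW ax /IH]; exact: le_trans.
exists v; first by rewrite av.
move=> w vw wb; rewrite -cats1 chain_length_cat /= addr0 -/v EFinD.
rewrite (arc_lengthD g av vw) -addeA leeD//.
  by rewrite /v; exact: chain_le_arc_length.
apply: (@le_trans _ _ (mdist (g v) (g w) + mdist (g w) (g b))%:E).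
  by rewrite lee_fin metric_triangle.
by rewrite EFinD leeD2r// mdist_le_arc_length.
Qed.

Variable c : curve X.
Hypothesis rc : rectifiable c.
Let g := Defs.path c.
Let ell := fine (length c).

Lemma curve_continuous u e : lo c <= u <= hi c -> 0 < e -> exists2 d, 0 < d &
  forall w, lo c <= w <= hi c -> `|u - w| < d -> mdist (g u) (g w) < e.
Proof.
move=> uI e0; have /subspace_continuousP := @path_continuous _ _ c.
move=> /(_ u); rewrite /= in_itv/= => /(_ uI).
move=> /metricType_numDomainType.cvgrPdist_lt /(_ e e0).
rewrite near_withinE => /nbhs_ballP[d /= d0 H]; exists d => // w wI uw.
by apply: H => //=; rewrite in_itv.
Qed.

Lemma sub_arc_fin a b : lo c <= a -> a <= b -> b <= hi c -> arc_length g a b \is a fin_num.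
Proof.
move=> la ab bh; rewrite ge0_fin_numE ?arc_length_ge0//.
apply: le_lt_trans rc; rewrite /length (arc_lengthD _ la (le_trans ab bh)) (arc_lengthD _ ab bh).
rewrite addeCA leeDl// adde_ge0// arc_length_ge0//.
Qed.

Let L u := fine (arc_length g (lo c) u).

Lemma arc_lengthL u : lo c <= u <= hi c -> arc_length g (lo c) u = (L u)%:E.
Proof. by move=> /andP[lu uh]; rewrite /L fineK// sub_arc_fin. Qed.

Lemma arc_lengthB u v : lo c <= u -> u <= v -> v <= hi c -> arc_length g u v = (L v - L u)%:E.
Proof.
move=> lu uv vh; have := arc_lengthD g lu uv.
rewrite !arc_lengthL ?lu ?(le_trans uv)// ?(le_trans lu)//.
rewrite -(fineK (sub_arc_fin lu uv vh)) -EFinD => -[->]; congr EFin; ring.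
Qed.

(** Arc length from the initial point takes every intermediate value, as it is
    monotone and continuous.  Let us be the supremum of the parameters where
    it is at most t.  A value above t at us contradicts continuity from the
    left, and one below t contradicts continuity from the right. *)
Lemma arc_length_surj t : 0 <= t <= ell -> exists2 u, lo c <= u <= hi c & L u = t.
Proof.
move=> /andP[t0 tl].
have lh := lo_le_hi c.
have loI : lo c <= lo c <= hi c by rewrite lexx.
have hiI : lo c <= hi c <= hi c by rewrite lexx lh.
have Lnd u v : lo c <= u -> u <= v -> v <= hi c -> L u <= L v.
  move=> lu uv vh; rewrite -subr_ge0 -lee_fin -arc_lengthB//; exact: arc_length_ge0.
have L0 : L (lo c) = 0.
  rewrite /L arc_lengthE (_ : [set _ | _ in _] = [set 0%E]) ?ereal_sup1//.
  apply/seteqP; split => [_ [s [ps ls] <-]|_ ->]; last by exists [::].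
  case: s ps ls => //= x s /andP[ax ps] ls.
  suff : x <= lo c by rewrite leNgt ax.
  by rewrite -ls; elim: s x ps {ax ls} => //= y s IH x /andP[/ltW xy /IH]; exact: le_trans.
pose S := [set u | lo c <= u <= hi c /\ L u <= t].
have S0 : S !=set0 by exists (lo c); split => //; rewrite L0.
have hS : has_sup S by split => //; exists (hi c) => u [/andP[]].
pose us := sup S.
have usI : lo c <= us <= hi c.
  apply/andP; split; first by apply: ub_le_sup; [exact: hS.2|split => //; rewrite L0].
  by apply: ge_sup => // u [/andP[]].
have /andP[lus ush] := usI.
exists us => //; apply/eqP; rewrite eq_le; apply/andP; split.
- rewrite leNgt; apply/negP => tL.
  have lo_us : lo c < us.
    by rewrite lt_neqAle lus andbT; apply/eqP => E; move: tL; rewrite -E L0 ltNge t0.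
  have : (t%:E < arc_length g (lo c) us)%E by rewrite arc_lengthL.
  rewrite arc_lengthE => /ereal_sup_gt[_ [s [ps ls] <-]]; rewrite lte_fin => ts.
  have [v /andP[lv vus] Hv] := chain_tail g lo_us ps ls.
  have e0 : 0 < chain_length g (lo c) s - t by rewrite subr_gt0.
  have [d d0 Hd] := curve_continuous usI e0.
  pose w := Num.max v (us - d / 2).
  have wus : w < us by rewrite /w gt_max vus/= ltrBlDr ltrDl divr_gt0.
  have vw : v <= w by rewrite /w le_max lexx.
  have dw : us - w < d.
    have : us - d / 2 <= w by rewrite /w le_max lexx orbT.
    lra.
  have lw : lo c <= w by apply: le_trans lv vw.
  have usw : 0 < us - w by rewrite subr_gt0.
  have [u [/andP[lu uh] uS] wu] := sup_adherent usw hS.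
  have {}wu : w <= u by move: wu; rewrite -/us; lra.
  have := Hv w vw wus; rewrite arc_lengthL ?lw ?(le_trans wu)// -EFinD lee_fin.
  have := Hd w; rewrite lw (le_trans wu uh) => /(_ isT).
  rewrite (ger0_norm (ltW usw)) => /(_ dw); rewrite metric_sym.
  have := Lnd w u lw wu uh; lra.
- rewrite leNgt; apply/negP => Lt.
  have us_hi : us < hi c.
    rewrite lt_neqAle ush andbT; apply/eqP => E; move: Lt; rewrite E.
    by have -> : L (hi c) = ell by []; rewrite ltNge tl.
  pose e := (t - L us) / 2.
  have e0 : 0 < e by rewrite divr_gt0// subr_gt0.
  have : (arc_length g us (hi c) - e%:E < arc_length g us (hi c))%E.
    by rewrite arc_lengthB// -EFinB lte_fin ltrBlDr ltrDl.
  rewrite {2}arc_lengthE => /ereal_sup_gt[_ [s [ps ls] <-]] Hs.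
  have [v /andP[usv vh] Hv] := chain_head g us_hi ps ls.
  have [d d0 Hd] := curve_continuous usI e0.
  pose w := Num.min v (us + d / 2).
  have wus : us < w by rewrite /w lt_min usv/= ltrDl divr_gt0.
  have wv : w <= v by rewrite /w ge_min lexx.
  have dw : w - us < d.
    have : w <= us + d / 2 by rewrite /w ge_min lexx orbT.
    lra.
  have wh : w <= hi c by exact: le_trans wv vh.
  have lw : lo c <= w by apply: le_trans lus (ltW wus).
  have Lw : t < L w.
    rewrite ltNge; apply/negP => Lw.
    have : w <= us by apply: ub_le_sup; [exact: hS.2|split => //; rewrite lw].
    by rewrite leNgt wus.
  have := lt_le_trans Hs (Hv w wus wv).
  rewrite !arc_lengthB// ?(ltW wus)// -!EFinB -EFinD lte_fin.
  have := Hd w; rewrite lw wh => /(_ isT).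
  rewrite ltr0_norm ?subr_lt0// opprB => /(_ dw).
  rewrite /e; lra.
Qed.

(** The parametrization is defined by a choice of parameter, which the
    previous lemma makes meaningful. *)
Lemma arc_paramP t : 0 <= t <= ell ->
  exists u, [/\ lo c <= u <= hi c, L u = t & arc_param c t = g u].
Proof.
move=> tI; have [u uI Lu] := arc_length_surj tI.
have H : [set u | (lo c <= u <= hi c)%R /\ arc_length (Defs.path c) (lo c) u = t%:E] u.
  by split => //; rewrite -Lu arc_lengthL.
have [vI Lv] := @getI _ _ u H.
exists (get [set u | (lo c <= u <= hi c)%R /\ arc_length (Defs.path c) (lo c) u = t%:E]).
by split => //; move: Lv; rewrite arc_lengthL// => -[].
Qed.

Lemma arc_param_lipschitz (s t : R) : 0 <= s <= ell -> 0 <= t <= ell ->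
  mdist (arc_param c s) (arc_param c t) <= `|s - t|.
Proof.
move=> /arc_paramP[u [/andP[lu uh] <- ->]] /arc_paramP[v [/andP[lv vh] <- ->]].
wlog uv : u v lu uh lv vh / u <= v.
  move=> H; have [/H|/ltW/H] := leP u v; first exact.
  by rewrite metric_sym distrC; exact.
rewrite -lee_fin; apply: le_trans (mdist_le_arc_length g uv) _.
by rewrite arc_lengthB// lee_fin distrC ler_norm.
Qed.

Lemma arc_length_ell : length c = ell%:E.
Proof. by rewrite /ell fineK// ge0_fin_numE// arc_length_ge0// lo_le_hi. Qed.

Lemma ell_ge0 : 0 <= ell.
Proof. by rewrite -lee_fin -arc_length_ell arc_length_ge0// lo_le_hi. Qed.

Lemma arc_param_lo : arc_param c 0 = g (lo c).
Proof.
have [|u [/andP[lu uh] Lu ->]] := @arc_paramP 0; first by rewrite lexx ell_ge0.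
apply/esym/mdist_positivity/eqP; rewrite eq_le mdist_ge0 andbT.
by rewrite -lee_fin; apply: le_trans (mdist_le_arc_length g lu) _; rewrite arc_lengthL ?lu// Lu.
Qed.

Lemma arc_param_hi : arc_param c ell = g (hi c).
Proof.
have [|u [/andP[lu uh] Lu ->]] := @arc_paramP ell; first by rewrite lexx ell_ge0.
apply/mdist_positivity/eqP; rewrite eq_le mdist_ge0 andbT.
rewrite -lee_fin; apply: le_trans (mdist_le_arc_length g uh) _; rewrite arc_lengthB// Lu.
by have -> : L (hi c) = ell by []; rewrite subrr.
Qed.

End arc_length_parametrization.

(** * Line integrals and exceptional curve families *)

Section line_integrals.
Context {R : realType} {X : pmetricType R}.
Local Open Scope ereal_scope.

Lemma borel_mu_measurable (mu : {outer_measure set X -> \bar R}) (g : X -> \bar R) :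
  metric_measure_space mu -> borel_fun g -> mu_measurable_fun mu g.
Proof.
move=> [_ [bc _] _ _] bg _ B mB; apply: bc.
exact: (bg measurableT B mB).
Qed.

Lemma continuous_borel_comp (phi : R -> X) (g : X -> \bar R) :
  (forall s t : R, mdist (phi s) (phi t) <= `|s - t|)%R -> borel_fun g ->
  measurable_fun setT (g \o phi).
Proof.
move=> lphi bg.
have mphi : measurable_fun setT (phi : R -> g_sigma_algebraType (@open X)).
  apply: (@measurability _ _ _ (g_sigma_algebraType (@open X)) setT phi (@open X) erefl) => _ [U oU <-].
  apply: open_measurable; rewrite setTI openE => t Ut; rewrite /interior.
  have /nbhs_ballP[e /= e0 eU] : nbhs (phi t) U by apply: open_nbhs_nbhs.
  rewrite -nbhs_ballE; exists e => // s ts; apply: eU; rewrite in_ball.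
  by apply: le_lt_trans (lphi _ _) _.
exact: (measurableT_comp (bg : measurable_fun _ (g : g_sigma_algebraType (@open X) -> _)) mphi).
Qed.

(** The parametrization is 1-Lipschitz on [0, length c] only; composing it with
    the projection of the line onto this interval makes it continuous
    everywhere without changing the integrand on the interval. *)
Lemma line_measurable (c : curve X) (g : X -> \bar R) : rectifiable c -> borel_fun g ->
  measurable_fun `[0%R, fine (length c)] (g \o arc_param c).
Proof.
move=> rc bg; set ell := fine (length c).
have l0 : (0 <= ell)%R := ell_ge0 rc.
pose clamp (t : R) := Num.max 0%R (Num.min t ell).
have clampI t : (0 <= clamp t <= ell)%R.
  by rewrite /clamp le_max lexx/= ge_max l0/= ge_min lexx orbT.
have clampK t : (0 <= t <= ell)%R -> clamp t = t.
  by move=> /andP[t0 tl]; rewrite /clamp (min_idPl tl) (max_idPr t0).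
have clampL s t : (`|clamp s - clamp t| <= `|s - t|)%R.
  wlog st : s t / (s <= t)%R.
    move=> H; have [/H//|/ltW/H] := leP s t.
    by rewrite distrC (distrC t).
  rewrite !ler0_norm ?subr_le0 ?opprB//; last first.
    by rewrite /clamp ge_max !le_max lexx/= le_min !ge_min st lexx !orbT.
  rewrite /clamp; case: (leP s ell) => sl; case: (leP t ell) => tl; case: (leP 0%R s) => ?; case: (leP 0%R t) => ?; case: (leP 0%R ell) => ?; lra.
apply: (@eq_measurable_fun _ _ _ _ _ (g \o (arc_param c \o clamp))).
  by move=> t; rewrite inE/= in_itv/= => tI; rewrite clampK.
apply: measurable_funTS; apply: continuous_borel_comp bg => s t.
by apply: le_trans (clampL s t); exact: arc_param_lipschitz.
Qed.

Lemma le_line_integral (c : curve X) (g h : X -> \bar R) : rectifiable c ->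
  borel_fun g -> borel_fun h -> (forall x, 0 <= g x) -> (forall x, g x <= h x) ->
  line_integral c g <= line_integral c h.
Proof.
move=> rc bg bh g0 gh; apply: ge0_le_integral => //.
- exact: (line_measurable rc bg).
- exact: (line_measurable rc bh).
Qed.

Lemma line_integralZ (c : curve X) (k : R) (g : X -> \bar R) : rectifiable c ->
  borel_fun g -> (forall x, 0 <= g x) -> (0 <= k)%R ->
  line_integral c (fun x => k%:E * g x) = k%:E * line_integral c g.
Proof.
move=> rc bg g0 k0; apply: ge0_integralZl_EFin => //.
exact: (line_measurable rc bg).
Qed.

End line_integrals.

Section exceptional_curves.
Context {R : realType} {X : pmetricType R}.
Variable mu : {outer_measure set X -> \bar R}.
Hypothesis hX : metric_measure_space mu.
Local Open Scope ereal_scope.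
Local Notation XM := (caratheodory_type mu).

Let supn (s : nat -> X -> \bar R) (x : X) := esups (s^~ x) 0%N.

Let le_supn s n x : s n x <= supn s x.
Proof. by apply: ereal_sup_ubound; exists n. Qed.

Let supn_le s x M : (forall n, s n x <= M) -> supn s x <= M.
Proof. by move=> H; apply: ge_ereal_sup => _ [n _ <-]. Qed.

(** The supremum is at most the r-th root of the sum of the r-th powers. *)
Lemma integral_supn (r : R) (s : nat -> X -> \bar R) : (0 < r)%R ->
  (forall n, mu_measurable_fun mu (s n)) -> (forall n x, 0 <= s n x) ->
  \int[cmeas mu]_x (supn s x `^ r) <= \sum_(n <oo) \int[cmeas mu]_x (s n x `^ r).
Proof.
move=> r0 ms s0.
have mS : mu_measurable_fun mu (supn s).
  exact: (@measurable_fun_esups _ XM R setT s ms 0%N).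
rewrite -(@integral_nneseries _ XM R (cmeas mu) setT measurableT (fun n x => s n x `^ r)).
- apply: ge0_le_integral => //.
  + by move=> x _; exact: poweR_ge0.
  + exact: measurable_poweR_comp.
  + have H : measurable_fun setT (fun x : XM => \sum_(i <oo | i \in xpredT) (s i x `^ r)).
      apply: ge0_emeasurable_sum; first by move=> n x _ _; exact: poweR_ge0.
      by move=> n _; exact: measurable_poweR_comp.
    by apply: eq_measurable_fun H => x _; apply: eq_eseriesl.
  + move=> x _.
    set S := \sum_(n <oo) _.
    have S0 : 0 <= S by apply: nneseries_ge0 => n _ _; exact: poweR_ge0.
    have -> : S = (S `^ r^-1) `^ r by rewrite -poweRrM mulVf ?gt_eqF// poweRe1.
    apply: gt0_ler_poweR; rewrite ?(ltW r0)// ?in_itv/= ?leey ?andbT ?poweR_ge0//.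
      exact: le_trans (s0 0%N x) (le_supn _ _ _).
    apply: supn_le => n.
    have -> : s n x = (s n x `^ r) `^ r^-1 by rewrite -poweRrM mulfV ?gt_eqF// poweRe1.
    apply: gt0_ler_poweR; rewrite ?invr_ge0 ?(ltW r0)// ?in_itv/= ?leey ?andbT ?poweR_ge0//.
    rewrite /S (nneseries_split _ n.+1); last by move=> *; exact: poweR_ge0.
    rewrite add0n big_mkord big_ord_recr/= -addeA addeCA leeDl//.
    by rewrite adde_ge0// ?sume_ge0 ?nneseries_ge0// => *; exact: poweR_ge0.
- by move=> n; exact: measurable_poweR_comp.
- by move=> n x _; exact: poweR_ge0.
Qed.

(** Choose admissible functions rho_n of the exceptional family with norms so
    small that the supremum G of g and of all (n+1) rho_n is still in L^p.
    Along an ordinary curve G is at least g.  Along an exceptional one the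
    line integral of G is at least n+1 for every n, hence infinite. *)
Lemma weak_upper_gradient_upper_gradient p (f g : X -> \bar R) : 1 <= p ->
  weak_upper_gradient mu p f g -> in_Lp mu p g ->
  exists2 G : X -> \bar R, upper_gradient f G & in_Lp mu p G.
Proof.
move=> p1 [bg g0 [Gam mod0 ug]] [mg gLp].
suff [rho [adm rLp]] : exists rho : nat -> X -> \bar R,
   (forall n, admissible Gam (rho n)) /\
   let s := fun n => if n is k.+1 then (fun x => k.+1%:R%:E * rho k x) else g in
   'N[cmeas mu]_p[supn s] < +oo.
  pose s := fun n => if n is k.+1 then (fun x => k.+1%:R%:E * rho k x) else g.
  have bs n : borel_fun (s n).
    case: n => [//|n]; apply: emeasurable_funM; first exact: measurable_cst.
    by case: (adm n).
  have s0 n x : 0 <= s n x.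
    case: n => [//|n]; apply: mule_ge0; first by rewrite lee_fin.
    by case: (adm n).
  have bS : borel_fun (supn s).
    exact: (@measurable_fun_esups _ (g_sigma_algebraType (@open X)) R setT s bs 0%N).
  exists (supn s); last by split => //; exact: borel_mu_measurable.
  split => //; first by move=> x; apply: le_trans (s0 0%N x) (le_supn _ _ _).
  move=> c rc lc; have [Gc|nGc] := pselect (Gam c); last first.
    apply: le_trans (ug c rc lc nGc) _.
    by apply: le_line_integral => // x; exact: (le_supn s 0).
  rewrite /upper_gradient_along; suff -> : line_integral c (supn s) = +oo by rewrite leey.
  apply/eqyP => A A0.
  apply: (@le_trans _ _ (line_integral c (s (Num.truncn A).+1))); last first.
    by apply: le_line_integral => // x; exact: le_supn.
  have [br r0 /(_ c Gc rc) H] := adm (Num.truncn A).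
  rewrite line_integralZ//.
  apply: (@le_trans _ _ ((Num.truncn A).+1%:R%:E * 1)).
    by rewrite mule1 lee_fin ltW// truncnS_gt.
  by rewrite lee_wpmul2l// lee_fin.
case: p p1 mod0 gLp {ug} => [r| |//].
- rewrite lee_fin => r1 /= mod0 gLp.
  have r0 : (0 < r)%R := lt_le_trans ltr01 r1.
  (* The factor (n+1)^r offsets the scaling of rho_n; the rest is summable. *)
  pose eps n : R := ((2 ^ n.+2)%:R^-1 / (n.+1%:R `^ r))%R.
  have eps0 n : (0 < eps n)%R.
    by rewrite divr_gt0// ?powR_gt0// invr_gt0 ltr0n expn_gt0.
  have /choice[rho Hrho] n : exists rho, admissible Gam rho /\
      \int[cmeas mu]_x (rho x `^ r) < (eps n)%:E.
    have /ereal_inf_lt[_ [rho adm <-] H] : ereal_inf [set \int[cmeas mu]_x (rho x `^ r) | rho in admissible Gam] < (eps n)%:E.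
      by rewrite mod0 lte_fin.
    by exists rho.
  exists rho; split; first by move=> n; case: (Hrho n).
  pose s := fun n => if n is k.+1 then (fun x => k.+1%:R%:E * rho k x) else g.
  change ('N[cmeas mu]_r%:E[supn s] < +oo).
  have ms n : mu_measurable_fun mu (s n).
    case: n => [//|n]; apply: emeasurable_funM; first exact: measurable_cst.
    by apply: borel_mu_measurable => //; case: (Hrho n) => -[].
  have s0 n x : 0 <= s n x.
    case: n => [//|n]; apply: mule_ge0; first by rewrite lee_fin.
    by case: (Hrho n) => -[].
  have S0 x : 0 <= supn s x by apply: le_trans (s0 0%N x) (le_supn _ _ _).
  rewrite unlock; apply: poweR_lty.
  under eq_integral do rewrite gee0_abs//.
  apply: le_lt_trans (integral_supn r0 ms s0) _.
  have Ig : \int[cmeas mu]_x (g x `^ r) < +oo.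
    have := Lnorm_integral_fin r1 gLp.
    by under eq_integral do rewrite gee0_abs//.
  have Ig0 : 0 <= \int[cmeas mu]_x (g x `^ r) by apply: integral_ge0 => x _; exact: poweR_ge0.
  (* The term with index 0 is the integral of g^r, the others come from the rho_n. *)
  pose a n := if n is n.+1 then 0 else \int[cmeas mu]_x (g x `^ r).
  have a0 n : 0 <= a n by case: n.
  apply: (@le_lt_trans _ _ (\sum_(n <oo) (a n + (1 / (2 ^ n.+1)%:R : R)%:E))).
    apply: lee_nneseries => [n _ _|n _]; first by apply: integral_ge0 => x _; exact: poweR_ge0.
    case: n => [|n]; first by rewrite /a leeDl// lee_fin divr_ge0.
    rewrite /a add0e /s.
    have [[br rho0 _] Hr] := Hrho n.
    have -> : \int[cmeas mu]_x ((n.+1%:R%:E * rho n x) `^ r) =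
        \int[cmeas mu]_x (n.+1%:R%:E `^ r * rho n x `^ r).
      by apply: eq_integral => x _; rewrite poweRM// lee_fin.
    rewrite poweR_EFin (@ge0_integralZl_EFin _ XM R (cmeas mu) setT measurableT _ _ _)//; last 2 first.
    - by move=> x _; exact: poweR_ge0.
    - by apply: measurable_poweR_comp; exact: borel_mu_measurable.
    apply: le_trans (lee_wpmul2l _ (ltW Hr)) _; first by rewrite lee_fin powR_ge0.
    rewrite -EFinM lee_fin /eps mulrC divfK ?gt_eqF ?powR_gt0// div1r.
    by rewrite lexx.
  apply: le_lt_trans (@epsilon_trick R a 1%R xpredT a0 ler01) _.
  apply: lte_add_pinfty; last exact: ltry.
  rewrite (nneseries_split _ 1%N)// big_mkord big_ord1 eseries0 ?adde0//.
  by case.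
- move=> _ mod0 gLp.
  have /(Lnormy_ae hX)[M M0 HM] := gLp.
  have /choice[rho Hrho] n : exists rho, admissible Gam rho /\
      'N[cmeas mu]_+oo[rho] < (n.+1%:R^-1)%:E.
    have /ereal_inf_lt[_ [rho adm <-] H] : ereal_inf [set 'N[cmeas mu]_+oo[rho] | rho in admissible Gam] < (n.+1%:R^-1 : R)%:E.
      by move: mod0; rewrite /modulus => ->; rewrite lte_fin invr_gt0.
    by exists rho.
  exists rho; split; first by move=> n; case: (Hrho n).
  pose s := fun n => if n is k.+1 then (fun x => k.+1%:R%:E * rho k x) else g.
  (* Each (n+1) rho_n is at most 1 almost everywhere, and g is at most M. *)
  change ('N[cmeas mu]_+oo[supn s] < +oo).
  apply: (@le_lt_trans _ _ (Num.max M 1)%:E); last exact: ltry.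
  apply/(LnormyP hX); apply/ae_null.
  have s0 n x : 0 <= s n x.
    case: n => [//|n]; apply: mule_ge0; first by rewrite lee_fin.
    by case: (Hrho n) => -[].
  have S0 x : 0 <= supn s x by apply: le_trans (s0 0%N x) (le_supn _ _ _).
  apply: (@mu_sub0 _ _ _ _ (\bigcup_n ~` [set x | `|s n x| <= (Num.max M 1)%:E])).
    move=> x nx; apply: contrapT => H; apply: nx => /=; rewrite gee0_abs//.
    apply: supn_le => n; apply: contrapT => nx; apply: H; exists n => //=.
    by rewrite gee0_abs.
  apply: mu_bigcup0 => -[|n].
    move/ae_null : HM; apply: mu_sub0 => x /= nx H; apply: nx.
    by apply: le_trans H _; rewrite lee_fin le_max lexx.
  have [_ /ltW/(LnormyP hX)/ae_null] := Hrho n; apply: mu_sub0 => x /= nx H; apply: nx.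
  rewrite abseM gee0_abs ?lee_fin//.
  apply: le_trans (lee_wpmul2l _ H) _; first by rewrite lee_fin.
  by rewrite -EFinM mulfV// lee_fin le_max lexx orbT.
Qed.
End exceptional_curves.

(** * Maximal functions and Newtonian functions *)

Section newtonian.
Context {R : realType} {X : pmetricType R}.
Variable mu : {outer_measure set X -> \bar R}.
Hypothesis hX : metric_measure_space mu.
Hypothesis hdbl : doubling mu.
Local Open Scope ereal_scope.
Local Notation XM := (caratheodory_type mu).

(** The exceptional set Z is covered, for every k, by balls of radius at most
    1 with nu > k mu, so k mu(Z) is bounded independently of k. *)
Lemma ae_maximal_finite (nu : set X -> \bar R) (V : R) :
  (forall A, 0 <= nu A) ->
  (forall s : seq (X * R), uniq s ->
    {in s &, forall a b, a != b -> ball a.1 a.2 `&` ball b.1 b.2 = set0} ->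
    \sum_(b <- s) nu (ball b.1 b.2) <= V%:E) ->
  mu (~` [set x | exists k : nat, forall r, (0 < r)%R -> (r * k.+1%:R < 1)%R ->
     nu (ball x r) <= k%:R%:E * mu (ball x r)]) = 0.
Proof.
move=> nu0 sumV; set Z := ~` _.
have [C C0 HC] := weak_type hX hdbl.
have V0 : (0 <= V)%R by have := sumV [::] isT; rewrite big_nil lee_fin; apply.
have bound k : k%:R%:E * mu Z <= (C * V)%:E.
  rewrite EFinM; apply: (HC [set b : X * R | (0 < b.2 <= 1)%R /\
     k%:R%:E * mu (ball b.1 b.2) <= nu (ball b.1 b.2)] Z nu k%:R 1%R) => //.
  - by move=> b [].
  - move=> x Zx; apply: contrapT => nx; apply: Zx; exists k => r r0 rk.
    rewrite leNgt; apply/negP => H; apply: nx; exists (x, r); last exact: ballxx.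
    split => /=; last exact: ltW.
    by rewrite r0/= ltW//; apply: le_lt_trans rk; rewrite ler_peMr ?(ltW r0)// ler1n.
  - by move=> b [].
  - by move=> s us _ sd; exact: sumV.
apply: mu_eq0.
have fZ : mu Z \is a fin_num.
  rewrite ge0_fin_numE//; apply: le_lt_trans (ltry (C * V)%R).
  by have := bound 1%N; rewrite mul1e.
rewrite leNgt; apply/negP => Z0.
have z0 : (0 < fine (mu Z))%R by rewrite fine_gt0// Z0 -ge0_fin_numE.
have [n Hn] : exists n : nat, (C * V / fine (mu Z) < n%:R)%R.
  by exists (Num.truncn (C * V / fine (mu Z))).+1; exact: truncnS_gt.
have := bound n.
by rewrite -(fineK fZ) -EFinM lee_fin -ler_pdivlMr// leNgt Hn.
Qed.

Lemma sum_disjoint_integral (h : X -> \bar R) (s : seq (X * R)) :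
  mu_measurable_fun mu h -> (forall x, 0 <= h x) -> uniq s ->
  {in s &, forall a b, a != b -> ball a.1 a.2 `&` ball b.1 b.2 = set0} ->
  \sum_(b <- s) \int[cmeas mu]_(x in ball b.1 b.2) h x <= \int[cmeas mu]_x h x.
Proof.
move=> mh h0 us sd.
have mB (b : X * R) : measurable (ball b.1 b.2 : set XM).
  exact: (ball_caratheodory hX b.1 b.2).
rewrite -(@ge0_integral_bigsetU _ XM R (cmeas mu) _ (fun b => ball b.1 b.2) h s)//.
- by apply: ge0_subset_integral => //; exact: bigsetU_measurable.
- apply/trivIsetP => a b sa sb ab; exact: sd.
- exact: measurable_funTS.
Qed.

(** The index k has to absorb the constant of the Poincare inequality and to
    be large enough for the dilated balls to have radius below d. *)
Lemma small_oscillation_p_mean p (f g : X -> \bar R) (x : X) (K d : R) (lam C : R) :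
  (0 < C)%R -> (1 <= lam)%R ->
  (forall (x : X) (r : R), (0 < r)%R ->
        avg mu (ball x r) (fun y => `|f y - avg mu (ball x r) f|)
        <= C%:E * r%:E * p_mean mu p (ball x (lam * r)%R) g) ->
  (0 <= K)%R -> (0 < d)%R ->
  (forall r, (0 < r < d)%R -> p_mean mu p (ball x r) g <= K%:E) ->
  exists k, small_oscillation mu f k x.
Proof.
move=> C0 l1 poin K0 d0 HK.
exists (Num.truncn (C * K + lam / d)).+1 => r r0 rk.
set k := (Num.truncn _).+1 in rk *.
have l0 : (0 < lam)%R := lt_le_trans ltr01 l1.
have kb : (C * K + lam / d < k%:R)%R by exact: truncnS_gt.
have ld0 : (0 < lam / d)%R by rewrite divr_gt0.
have CK0 : (0 <= C * K)%R by rewrite mulr_ge0// ltW.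
apply: le_trans (poin x r r0) _.
apply: (@le_trans _ _ (C%:E * r%:E * K%:E)).
  apply: lee_wpmul2l; first by rewrite -EFinM lee_fin mulr_ge0// ltW.
  apply: HK; rewrite mulr_gt0//= mulrC -ltr_pdivlMr// -(invf_div lam d) -div1r.
  rewrite ltr_pdivlMr//; apply: le_lt_trans rk; rewrite ler_pM2l//.
  by rewrite -natr1; lra.
by rewrite -!EFinM lee_fin mulrAC ler_pM2r//; lra.
Qed.

(** For finite p this is the finiteness of the maximal function of g^p.  For
    p infinite the essential supremum over the whole space is a bound. *)
Lemma p_mean_le p (g : X -> \bar R) : 1 <= p ->
   mu_measurable_fun mu g -> (forall x, 0 <= g x) -> 'N[cmeas mu]_p[g] < +oo ->
  mu (~` [set x | exists K d : R, [/\ (0 <= K)%R, (0 < d)%R &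
    forall r, (0 < r < d)%R -> p_mean mu p (ball x r) g <= K%:E]]) = 0.
Proof.
move=> p1 mg g0; case: p p1 => [p| |//].
- rewrite lee_fin => p1 gLp.
  have := Lnorm_integral_fin p1 gLp.
  under eq_integral do rewrite gee0_abs//.
  set V := \int[_]_x _ => finV.
  have V0 : 0 <= V by apply: integral_ge0 => x _; exact: poweR_ge0.
  have mgp : mu_measurable_fun mu (fun x => g x `^ p) by exact: measurable_poweR_comp.
  have := @ae_maximal_finite (fun A => \int[cmeas mu]_(x in A) (g x `^ p)) (fine V).
  move=> /(_ _ _)/mu_sub0; apply.
  {
  move=> x Hx [k Hk]; apply: Hx.
  exists (k%:R `^ p^-1)%R, (k.+1%:R^-1)%R; split.
  + exact: powR_ge0.
  + by rewrite invr_gt0.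
  move=> r /andP[r0 rk]; rewrite /p_mean -poweR_EFin.
  have b0 : (0 < fine (mu (ball x r)))%R.
    by rewrite fine_gt0// mu_ball_gt0//= mu_ball_fin.
  have i0 : 0 <= \int[cmeas mu]_(y in ball x r) (g y `^ p).
    by apply: integral_ge0 => y _; exact: poweR_ge0.
  apply: gt0_ler_poweR; rewrite ?invr_ge0 ?(le_trans ler01)// ?in_itv/= ?leey ?andbT ?lee_fin//.
    by rewrite /avg mule_ge0// lee_fin invr_ge0 ltW.
  rewrite /avg muleC lee_pdivrMr// fineK ?mu_ball_fin_num//.
  by apply: Hk => //; rewrite -ltr_pdivlMr// div1r.
  }
  + by move=> A; apply: integral_ge0 => x _; exact: poweR_ge0.
  + move=> s us sd; rewrite fineK ?ge0_fin_numE//.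
    by apply: sum_disjoint_integral => // x; exact: poweR_ge0.
- move=> _ gLp.
  rewrite (_ : ~` _ = set0) ?outer_measure0//; apply/seteqP; split => // x /=; apply.
  exists (fine 'N[cmeas mu]_+oo[g]), 1%R; split => //; first by apply: fine_ge0; exact: Lnorm_ge0.
  move=> r _; rewrite fineK ?ge0_fin_numE ?Lnorm_ge0// /p_mean.
  rewrite unlock/= (mu_setT_gt0 hX); apply: ess_sup_inf.le_ess_sup; apply: aeW => y /=.
  by rewrite patchE; case: ifP => // _; rewrite abse0.
Qed.

Lemma newtonian_approx_differentiable (S : chart_system X) p (f : X -> \bar R) :
  1 <= p -> approx_differentiable_structure mu S -> weak_poincare mu p ->
  newtonian mu p f -> ae_approx_differentiable mu S f.
Proof.
move=> p1 hS [lam [C [l1 C0 poin]]] [fLp [g wg gLp]].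
have [G [bG G0 uG] [mG GLp]] := weak_upper_gradient_upper_gradient hX p1 wg gLp.
have mf : mu_measurable_fun mu f by case: fLp.
apply: (approx_differentiable_small_oscillation hX hdbl) => //.
- move=> x r; apply: (Lp_locally_integrable hX p1) => //; last exact: mu_ball_fin.
  exact: ball_caratheodory.
- exact: (Lp_ae_fin hX hdbl p1).
- apply: mu_sub0 (p_mean_le p1 mG G0 GLp) => x Hx [K [d [K0 d0 H]]]; apply: Hx.
  apply: (small_oscillation_p_mean C0 l1 _ K0 d0 H) => y r r0.
  by apply: poin.
Qed.
End newtonian.

(** * Increments controlled by a lower Dini derivative *)

Section dini_increment.
Context {R : realType}.
Local Open Scope ereal_scope.
Local Notation leb := (@lebesgue_measure R).

Lemma nneseries_ge_term (a : nat -> \bar R) j : (forall i, 0 <= a i) ->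
  a j <= \sum_(i <oo) a i.
Proof.
move=> a0; rewrite (nneseries_split _ j.+1)// add0n big_mkord big_ord_recr/= -addeA addeCA leeDl//.
by rewrite adde_ge0// ?sume_ge0// nneseries_ge0.
Qed.

Lemma nneseries_single (a : nat -> \bar R) j : (forall i, 0 <= a i) ->
  (forall i, i != j -> a i = 0) -> \sum_(i <oo) a i = a j.
Proof.
move=> a0 aj; rewrite (nneseries_split _ j.+1)// add0n big_mkord big_ord_recr/=.
rewrite big1; last by move=> i _; rewrite aj// lt_eqF//; exact: ltn_ord.
rewrite add0e eseries0 ?adde0// => i ji _; by rewrite aj// gt_eqF.
Qed.

(** A form of the Vitali-Caratheodory theorem, sufficient for the next lemma.
    On the level set A j, where G lies between j e and (j+1) e, the majorant
    is (j+2) e, carried by an open set U j that exceeds A j by very little.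
    Openness makes the majorant at least G s + e not only at s but on a
    neighbourhood of s. *)
Lemma lsc_majorant (ell : R) (G : R -> \bar R) (e : R) : (0 <= ell)%R -> (0 < e)%R ->
  measurable_fun `[0%R, ell] G ->
  (forall s, (0 <= s <= ell)%R -> 0 <= G s /\ G s < +oo) ->
  exists psi : R -> \bar R, [/\ forall t, 0 <= psi t,
    measurable_fun setT psi,
    \int[leb]_(t in `[0%R, ell]) psi t <=
      \int[leb]_(t in `[0%R, ell]) G t + (e * (2 * ell + 1))%:E &
    forall s, (0 <= s <= ell)%R -> exists2 d, (0 < d)%R &
      forall t, (`|s - t| < d)%R -> (fine (G s) + e)%:E <= psi t].
Proof.
move=> l0 e0 mG G0.
have mI (a b : R) : measurable (`[a, b] : set R) by exact: measurable_itv.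
have G0' s : `[0%R, ell]%classic s -> 0 <= G s.
  by rewrite /= in_itv/= => /G0[].
pose w j : R := (j.+2%:R * e)%R.
have w0 j : (0 < w j)%R by rewrite mulr_gt0.
pose A j := `[0%R, ell] `&` [set s | (j%:R * e)%:E <= G s] `&`
   (`[0%R, ell] `&` [set s | G s < (j.+1%:R * e)%:E]).
have mA j : measurable (A j).
  apply: measurableI.
  - exact: emeasurable_fun_c_infty.
  - exact: emeasurable_fun_infty_o.
have fA j : leb (A j) < +oo.
  apply: le_lt_trans (_ : leb (`[0%R, ell] : set R) < +oo).
    apply: le_measure; rewrite ?inE; [exact: mA|exact: mI|by move=> s [[]]].
  by rewrite lebesgue_measure_itv/=; case: ifP => // _; rewrite -EFinB ltry.
(* The excess of U j over A j is weighted by w j; the weighted excesses sum to at most e. *)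
pose del j : R := ((e / (2 ^ j.+1)%:R) / w j)%R.
have del0 j : (0 < del j)%R by rewrite !divr_gt0// ltr0n expn_gt0.
have /choice[U HU] j : exists U : set R, [/\ open U, A j `<=` U & leb (U `\` A j) < (del j)%:E].
  exact: (@lebesgue_regularity_outer R (A j) (del j) (mA j) (fA j) (del0 j)).
have mU j : measurable (U j) by apply: open_measurable; case: (HU j).
pose ps j (t : R) : \bar R := (w j)%:E * (\1_(U j) t)%:E.
have mind (B D : set R) : measurable B -> measurable_fun D (fun t : R => (\1_B t : R)%:E).
  by move=> mB; apply: measurable_funTS; apply/measurable_EFinP; exact: measurable_indic.
have ps0 j t : 0 <= ps j t by rewrite mule_ge0// lee_fin ?(ltW (w0 j)).
have mps j (D : set R) : measurable_fun D (ps j).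
  by apply: emeasurable_funM => //; exact: mind.
pose psi t := \sum_(j <oo) ps j t.
have psi0 t : 0 <= psi t by apply: nneseries_ge0.
have mpsi (D : set R) : measurable_fun D psi.
  have H : measurable_fun D (fun x => \sum_(i <oo | i \in xpredT) ps i x).
    by apply: ge0_emeasurable_sum.
  by apply: eq_measurable_fun H => x _; apply: eq_eseriesl.
have Ipsi : \int[leb]_(t in `[0%R, ell]) psi t <= \int[leb]_(t in `[0%R, ell]) G t + (e * (2 * ell + 1))%:E.
  rewrite integral_nneseries//; last by move=> j; exact: mps.
  have term j : \int[leb]_(t in `[0%R, ell]) ps j t <= (w j)%:E * leb (A j) + (e / (2 ^ j.+1)%:R)%:E.
    rewrite ge0_integralZl_EFin//; last 2 first.
    - exact: mind.
    - exact: ltW.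
    rewrite (@integral_indic _ _ _ leb _ (mI _ _) _ (mU j)).
    have mUI : measurable (U j `&` `[0%R, ell] : set R) := measurableI _ _ (mU j) (mI _ _).
    have mUA : measurable (U j `\` A j) := measurableD (mU j) (mA j).
    apply: (@le_trans _ _ ((w j)%:E * (leb (A j) + (del j)%:E))).
      apply: lee_wpmul2l; first by rewrite lee_fin ltW.
      apply: (@le_trans _ _ (leb (A j `|` (U j `\` A j)))).
        apply: le_measure; rewrite ?inE; [exact: mUI|exact: (measurableU _ _ (mA j) mUA)|].
        by move=> t [Ut _]; have [At|At] := pselect (A j t); [left|right].
      apply: le_trans (@measureU2 _ _ _ leb _ _ (mA j) mUA) _.
      by rewrite leeD2l// ltW//; case: (HU j).
    rewrite ge0_muleDr ?lee_fin ?(ltW (del0 j))// leeD2l// -EFinM lee_fin.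
    by rewrite /del mulrC divfK ?gt_eqF.
  apply: le_trans (lee_nneseries _ (fun j _ => term j)) _.
    by move=> j _ _; apply: integral_ge0.
  apply: le_trans (@epsilon_trick R (fun j => (w j)%:E * leb (A j)) e xpredT _ (ltW e0)) _.
    by move=> j; rewrite mule_ge0// lee_fin ltW.
  rewrite mulrDr mulr1 EFinD addeA leeD2r//.
  rewrite (_ : \sum_(_ <oo) _ = \int[leb]_(t in `[0%R, ell]) \sum_(j <oo) ((w j)%:E * (\1_(A j) t)%:E)); last first.
    rewrite integral_nneseries//; last 2 first.
    - by move=> j; apply: emeasurable_funM => //; exact: mind.
    - by move=> j t _; rewrite mule_ge0// lee_fin ltW.
    apply: eq_eseriesr => j _; rewrite ge0_integralZl_EFin//; last 2 first.
    - exact: mind.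
    - exact: ltW.
    by rewrite (@integral_indic _ _ _ leb _ (mI _ _) _ (mA j)) setIidl// => t [[]].
  apply: (@le_trans _ _ (\int[leb]_(t in `[0%R, ell]) (G t + (2 * e)%:E))).
    apply: ge0_le_integral => //.
    - move=> t _; apply: nneseries_ge0 => j _ _; rewrite mule_ge0// lee_fin ltW//.
    - have H : measurable_fun (`[0%R, ell] : set R) (fun x => \sum_(i <oo | i \in xpredT) ((w i)%:E * (\1_(A i) x)%:E)).
        apply: ge0_emeasurable_sum => [j t _ _|j _]; first by rewrite mule_ge0// lee_fin ltW.
        by apply: emeasurable_funM => //; exact: mind.
      by apply: eq_measurable_fun H => x _; apply: eq_eseriesl.
    - by apply: emeasurable_funD => //; exact: measurable_cst.
    move=> t; rewrite /= in_itv/= => tI; have [Gt0 Gtfin] := G0 _ tI.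
    have Gf : G t \is a fin_num by rewrite ge0_fin_numE.
    pose j := Num.truncn (fine (G t) / e).
    have /andP[j1 j2] : (j%:R * e <= fine (G t) < j.+1%:R * e)%R.
      rewrite -ler_pdivlMr// -ltr_pdivrMr// truncnS_gt andbT truncn_le// divr_ge0 ?fine_ge0// ltW//.
    have Aj i : A i t -> i = j.
      move=> [[_ /= ij1] [_ /= ij2]]; move: ij1 ij2; rewrite -(fineK Gf) lee_fin lte_fin => ij1 ij2.
      have lij : (i < j.+1)%N.
        by rewrite -(ltr_nat R) -(ltr_pM2r e0); exact: le_lt_trans ij1 j2.
      have lji : (j < i.+1)%N.
        by rewrite -(ltr_nat R) -(ltr_pM2r e0); exact: le_lt_trans j1 ij2.
      by apply/eqP; rewrite eqn_leq -ltnS lij -ltnS lji.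
    rewrite (@nneseries_single _ j); last 2 first.
    - by move=> i; rewrite mule_ge0// lee_fin ltW.
    - by move=> i ij; rewrite indicE memNset ?mule0// => /Aj E; rewrite E eqxx in ij.
    apply: (@le_trans _ _ (w j)%:E).
      rewrite -[leRHS]mule1; apply: lee_wpmul2l; first by rewrite lee_fin ltW.
      by rewrite lee_fin indicE; case: (_ \in _).
    rewrite -(fineK Gf) -EFinD lee_fin /w -addn2 natrD mulrDl lerD2r.
    exact: j1.
  rewrite ge0_integralD//; last by move=> t _; rewrite lee_fin mulr_ge0// ltW.
  have len : leb (`[0%R, ell] : set R) = ell%:E.
    rewrite lebesgue_measure_itv/= lte_fin; case: ltP => H; first by rewrite oppr0 adde0.
    by congr EFin; apply/esym/eqP; rewrite eq_le l0 H.
  rewrite leeD2l// integral_cst//.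
  have -> : (e * (2 * ell))%:E = (2 * e)%:E * leb `[0%R, ell].
    by rewrite len -EFinM; congr EFin; ring.
  exact: lexx.
exists psi; split => //.
move=> s sI; have [Gs0 Gsfin] := G0 _ sI.
have Gf : G s \is a fin_num by rewrite ge0_fin_numE.
pose j := Num.truncn (fine (G s) / e).
have /andP[j1 j2] : (j%:R * e <= fine (G s) < j.+1%:R * e)%R.
  rewrite -ler_pdivlMr// -ltr_pdivrMr// truncnS_gt andbT truncn_le// divr_ge0 ?fine_ge0// ltW//.
have As : A j s.
  by split; split; rewrite /= ?in_itv//= -(fineK Gf) ?lee_fin ?lte_fin.
have [oU AU _] := HU j.
have /nbhs_ballP[d /= d0 dU] : nbhs s (U j) by apply: open_nbhs_nbhs; split => //; exact: AU.
exists d => // t st.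
apply: (@le_trans _ _ (w j)%:E).
  by rewrite lee_fin /w -natr1 mulrDl mul1r lerD2r ltW.
apply: le_trans (nneseries_ge_term j (ps0^~ t)).
by rewrite /ps indicE mem_set ?mule1//; apply: dU.
Qed.

(** Only arbitrarily small steps to the right with a controlled increment are
    assumed.  Let z be the supremum of the s such that the estimate holds on
    [0, s] with the majorant psi in place of G.  It holds
    at z by continuity of h.  If z < ell, a controlled step from z, on which
    psi is at least G z + e, reaches a larger s. *)
Lemma increment_le_integral_dini (ell : R) (h : R -> R) (G : R -> \bar R) : (0 <= ell)%R ->
  (forall s e, (0 <= s <= ell)%R -> (0 < e)%R -> exists2 d, (0 < d)%R &
     forall t, (0 <= t <= ell)%R -> (`|s - t| < d)%R -> (`|h s - h t| < e)%R) ->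
  measurable_fun `[0%R, ell] G ->
  (forall s, (0 <= s <= ell)%R -> 0 <= G s /\ G s < +oo) ->
  (forall s e d, (0 <= s < ell)%R -> (0 < e)%R -> (0 < d)%R ->
     exists rho, [/\ (0 < rho < d)%R, (s + rho <= ell)%R &
       (`|h (s + rho) - h s| <= (fine (G s) + e) * rho)%R]) ->
  (`|h ell - h 0|%R)%:E <= \int[leb]_(t in `[0%R, ell]) G t.
Proof.
move=> l0 hc mG G0 dini.
have mI (a b : R) : measurable (`[a, b] : set R) by exact: measurable_itv.
suff key e : (0 < e)%R -> (`|h ell - h 0|%R)%:E <= \int[leb]_(t in `[0%R, ell]) G t + (e * (2 * ell + 1))%:E.
  apply/lee_addgt0Pr => e e0.
  have K0 : (0 < 2 * ell + 1)%R by rewrite ltr_wpDl// mulr_ge0.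
  have := key (e / (2 * ell + 1))%R; rewrite divr_gt0// => /(_ isT).
  by rewrite divfK// gt_eqF.
move=> e0.
have [psi [psi0 mpsiT Ipsi lpsi]] := lsc_majorant l0 e0 mG G0.
have mpsi (D : set R) : measurable_fun D psi by exact: measurable_funTS.
apply: le_trans Ipsi.
pose F s := \int[leb]_(t in `[0%R, s]) psi t.
have Fmono s t : (s <= t)%R -> F s <= F t.
  move=> st; apply: ge0_subset_integral => //; first exact: mpsi.
  by move=> x; rewrite /= !in_itv/= => /andP[-> /le_trans]; exact.
pose S := [set s | (0 <= s <= ell)%R /\ (`|h s - h 0|%R)%:E <= F s].
have S0 : S 0%R.
  by split; rewrite ?lexx// subrr normr0; apply: integral_ge0.
have hS : has_sup S by split; [exists 0%R|exists ell => s [/andP[]]].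
pose z := sup S.
have z0 : (0 <= z)%R by apply: ub_le_sup => //; exact: hS.2.
have zl : (z <= ell)%R by apply: ge_sup => //; [exists 0%R|move=> s [/andP[]]].
have Sz : S z.
  split; first by rewrite z0.
  apply/lee_addgt0Pr => e1 e10.
  have [|d d0 Hd] := hc z e1 _ e10; first by rewrite z0.
  have [s [/andP[s0 sl] Fs] sz] := sup_adherent d0 hS.
  have sz' : (s <= z)%R by apply: ub_le_sup; [exact: hS.2|split => //; rewrite s0].
  have hzs : (`|h z - h s| < e1)%R.
    apply: Hd; first by rewrite s0.
    by rewrite ger0_norm ?subr_ge0//; move: sz; rewrite -/z; lra.
  apply: (@le_trans _ _ ((`|h s - h 0|%R)%:E + e1%:E)).
    rewrite -EFinD lee_fin; have := ler_normD (h z - h s)%R (h s - h 0)%R.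
    rewrite subrKA; lra.
  by rewrite leeD2r//; apply: le_trans Fs (Fmono _ _ sz').
suff <- : z = ell by case: Sz.
apply/eqP; rewrite eq_le zl/= leNgt; apply/negP => zlt.
have zI : (0 <= z <= ell)%R by rewrite z0.
have [d d0 dpsi] := lpsi z zI.
have [|rho [/andP[r0 rd] zr Hr]] := dini z e d _ e0 d0; first by rewrite z0.
have zrI : (0 <= z + rho <= ell)%R by rewrite zr addr_ge0// ltW.
suff : S (z + rho)%R.
  by move=> /(ub_le_sup hS.2); rewrite -/z gerDl leNgt r0.
split => //.
have -> : F (z + rho)%R = F z + \int[leb]_(t in `]z, (z + rho)%R]) psi t.
  rewrite /F -ge0_integral_setU//; last 2 first.
  - exact: mpsi.
  - by apply/disj_setPS => t []; rewrite /= !in_itv/= => /andP[_ tz] /andP[]; rewrite ltNge tz.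
  congr (\int[_]_(_ in _) _); apply/seteqP; split => t; rewrite /= !in_itv/=.
    move=> /andP[t0 tr]; have [tz|zt] := leP t z; first by left; rewrite t0.
    by right.
  case=> [/andP[t0 tz]|/andP[zt tr]].
    by rewrite t0/= (le_trans tz)// lerDl ltW.
  by rewrite tr andbT ltW// (le_lt_trans z0).
have Hpsi : ((fine (G z) + e) * rho)%:E <= \int[leb]_(t in `]z, (z + rho)%R]) psi t.
  have Gz0 : (0 <= fine (G z) + e)%R by rewrite addr_ge0 ?(ltW e0)// fine_ge0//; case: (G0 z zI).
  have len : leb (`]z, (z + rho)%R] : set R) = rho%:E.
    rewrite lebesgue_measure_itv/= lte_fin ltrDl r0 -EFinD.
    by rewrite addrAC subrr add0r.
  have -> : ((fine (G z) + e) * rho)%:E = \int[leb]_(t in `]z, (z + rho)%R]) cst (fine (G z) + e)%:E t.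
    rewrite integral_cst; last by apply: measurable_itv.
    rewrite EFinM; congr (_ * _); exact/esym/len.
  apply: ge0_le_integral => //.
  - exact: mpsi.
  - move=> t; rewrite /= in_itv/= => /andP[zt tr]; apply: dpsi.
    by rewrite ltr0_norm ?subr_lt0//; lra.
case: Sz => _ Hz; apply: le_trans (leeD Hz Hpsi); rewrite -EFinD lee_fin.
have -> : (h (z + rho) - h 0 = (h z - h 0) + (h (z + rho) - h z))%R by ring.
by apply: le_trans (ler_normD _ _) _; rewrite lerD2l; apply: le_trans Hr _.
Qed.
End dini_increment.

(** * The lower Lipschitz constant is an upper gradient *)

Section lower_lipschitz_constant.
Context {R : realType} {X : pmetricType R}.
Implicit Types (u : X -> R) (x y : X).
Local Open Scope ereal_scope.

Definition dilation_at u (rho : R) x : \bar R :=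
  ereal_sup [set (`|u x - u y| / rho)%:E | y in ball x rho].

Lemma dilation_at_ge0 u rho x : (0 < rho)%R -> 0 <= dilation_at u rho x.
Proof.
move=> r0; apply: le_trans (_ : (`|u x - u x| / rho)%:E <= _).
  by rewrite lee_fin divr_ge0// ltW.
by apply: ereal_sup_ubound; exists x => //; exact: ballxx.
Qed.

Lemma lower_lipE u x : lower_lip u x =
  ereal_sup [set ereal_inf [set dilation_at u rho x | rho in V] | V in (0%R : R)^'+].
Proof.
rewrite /lower_lip /limf_einf /limf_esup /ereal_inf oppeK; congr ereal_sup.
apply/seteqP; split => [_ [_ [V HV <-] <-]|_ [V HV <-]].
  by exists V => //; rewrite image_comp.
exists (ereal_sup [set - dilation_at u rho x | rho in V]).
  by exists V.
by rewrite image_comp.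
Qed.

(** Being a lower limit, a small value of the lower Lipschitz constant only
    provides arbitrarily small good radii, not all small radii. *)
Lemma lower_lip_lt u x c d : lower_lip u x < c -> (0 < d)%R ->
  exists2 rho, (0 < rho < d)%R & dilation_at u rho x < c.
Proof.
move=> + d0; apply: contraPP => nr; apply/negP; rewrite -leNgt lower_lipE.
apply: le_trans (_ : ereal_inf [set dilation_at u rho x | rho in [set r | (0 < r < d)%R]] <= _).
  apply: le_ereal_inf_tmp => _ [rho rd <-]; rewrite leNgt; apply/negP => H.
  by apply: nr; exists rho.
apply: ereal_sup_ubound; exists [set r | (0 < r < d)%R] => //.
by apply/at_right0P; exists d.
Qed.

Lemma lower_lip_ge u x c d : (0 < d)%R ->
  (forall rho, (0 < rho < d)%R -> c <= dilation_at u rho x) -> c <= lower_lip u x.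
Proof.
move=> d0 H; rewrite leNgt; apply/negP => /lower_lip_lt /(_ d0)[rho /H].
by rewrite leNgt => /negP.
Qed.

Lemma lower_lip_ge0 u x : 0 <= lower_lip u x.
Proof. by apply: (lower_lip_ge ltr01) => rho /andP[r0 _]; exact: dilation_at_ge0. Qed.

Lemma lower_lip_lty u x : locally_lipschitz u -> lower_lip u x < +oo.
Proof.
move=> /(_ x)[r [L [r0 HL]]]; apply: le_lt_trans (ltry `|L|%R).
rewrite lower_lipE; apply: ge_ereal_sup => _ [V /at_right0P[d d0 HV] <-].
pose rho := (Num.min r d / 2)%R.
have m0 : (0 < Num.min r d)%R by rewrite lt_min r0.
have rho0 : (0 < rho)%R by rewrite divr_gt0.
have rhom : (rho < Num.min r d)%R by rewrite /rho; lra.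
apply: le_trans (_ : dilation_at u rho x <= _).
  apply: ereal_inf_lbound; exists rho => //; apply: HV; rewrite rho0/=.
  by apply: lt_le_trans rhom _; rewrite ge_min lexx orbT.
apply: ge_ereal_sup => _ [y xy <-]; rewrite lee_fin ler_pdivrMr//.
move: xy; rewrite in_ball => xy.
have xr : (mdist x y < r)%R.
  by apply: lt_le_trans xy _; apply: le_trans (ltW rhom) _; rewrite ge_min lexx.
have H := HL x y (ballxx _ r0); rewrite in_ball in H; have {H} H := H xr.
apply: le_trans H _; apply: (@le_trans _ _ (`|L| * mdist x y)%R).
  by rewrite ler_wpM2r ?mdist_ge0// ler_norm.
by rewrite ler_wpM2l// ltW.
Qed.

Lemma locally_lipschitz_near u x e : locally_lipschitz u -> (0 < e)%R ->
  exists2 d, (0 < d)%R & forall y, (mdist x y < d)%R -> (`|u x - u y| < e)%R.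
Proof.
move=> /(_ x)[r [L [r0 HL]]] e0.
have L0 : (0 < `|L| + 1)%R by rewrite ltr_wpDl.
exists (Num.min r (e / (`|L| + 1)))%R; first by rewrite lt_min r0 divr_gt0.
move=> y; rewrite lt_min ltr_pdivlMr// => /andP[xr xe].
have H := HL x y (ballxx _ r0); rewrite in_ball in H; apply: le_lt_trans (H xr) _.
apply: le_lt_trans xe; rewrite mulrC ler_wpM2l ?mdist_ge0//.
by have := ler_norm L; lra.
Qed.

Lemma borel_fun_open (g : X -> \bar R) :
  (forall a : R, open [set x | a%:E < g x]) -> borel_fun g.
Proof.
move=> og.
apply: (@measurability _ _ (g_sigma_algebraType (@open X)) _ setT g _ (ErealGenOInfty.measurableE R)).
move=> _ [_ [a ->] <-]; rewrite setTI; apply: sub_sigma_algebra.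
rewrite (_ : _ @^-1` _ = [set x | a%:E < g x]); first exact: og.
by apply/seteqP; split => x /=; rewrite in_itv/= ?andbT.
Qed.

Lemma borel_locally_lipschitz u : locally_lipschitz u -> borel_fun (EFin \o u).
Proof.
move=> Lu; apply: borel_fun_open => a; rewrite openE => x /=; rewrite lte_fin => ax.
have [|d d0 Hd] := @locally_lipschitz_near u x (u x - a)%R Lu; first by rewrite subr_gt0.
rewrite /interior -nbhs_ballE; exists d => // y; rewrite in_ball => /Hd /=.
by rewrite lte_fin ltr_norml; lra.
Qed.

(** The balls in the definition are open, so the dilation is lower
    semicontinuous. *)
Lemma borel_dilation_at u rho : locally_lipschitz u -> (0 < rho)%R ->
  borel_fun (dilation_at u rho).
Proof.
move=> Lu r0; apply: borel_fun_open => a; rewrite openE => x /= /ereal_sup_gt[_ [y xy <-]].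
rewrite in_ball in xy; rewrite lte_fin ltr_pdivlMr// => ay.
have [|d d0 Hd] := @locally_lipschitz_near u x (`|u x - u y| - a * rho)%R Lu.
  by rewrite subr_gt0.
rewrite /interior -nbhs_ballE; exists (Num.min d (rho - mdist x y))%R => /=.
  by rewrite lt_min d0 subr_gt0.
move=> z; rewrite in_ball lt_min => /andP[/Hd xz xz'] /=.
apply: lt_le_trans (_ : (`|u z - u y| / rho)%:E <= _).
  rewrite lte_fin ltr_pdivlMr//; have := ler_normD (u x - u z)%R (u z - u y)%R.
  by rewrite subrKA; lra.
apply: ereal_sup_ubound; exists y => //; rewrite in_ball.
by have := metric_triangle z x y; rewrite (metric_sym z x); lra.
Qed.

(** Enumeration of the rational radii below 1/(n+1).  Codes of no such
    rational are sent to the radius 1/(n+2), so that every value is a valid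
    radius. *)
Let test_radius n k : R :=
  if unpickle k is Some q then
    if (0 < (ratr q : R) < n.+1%:R^-1)%R then ratr q else (n.+2%:R^-1)%R
  else (n.+2%:R^-1)%R.

Let test_radiusP n k : (0 < test_radius n k < n.+1%:R^-1)%R.
Proof.
have H : (0 < (n.+2%:R^-1 : R) < n.+1%:R^-1)%R.
  by rewrite invr_gt0 ltr0n/= ltf_pV2 ?posrE ?ltr0n// ltr_nat.
by rewrite /test_radius; case: unpickle => [q|]//; case: ifP.
Qed.

(** Rational radii suffice because rho times the dilation at radius rho is
    nondecreasing in rho: a good radius can be lowered slightly to a rational
    one.  This is what makes the lower Lipschitz constant a Borel function. *)
Lemma lower_lip_countable u x : lower_lip u x =
  esups (fun n => einfs (fun k => dilation_at u (test_radius n k) x) 0%N) 0%N.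
Proof.
apply/eqP; rewrite eq_le; apply/andP; split.
- rewrite lower_lipE; apply: ge_ereal_sup => _ [V /at_right0P[d d0 HV] <-].
  pose n := Num.truncn (d^-1)%R.
  have nd : (n.+1%:R^-1 < d)%R.
    by rewrite invf_plt ?posrE ?ltr0n// truncnS_gt.
  apply: le_trans (_ : einfs (fun k => dilation_at u (test_radius n k) x) 0%N <= _); last first.
    by apply: ereal_sup_ubound; exists n.
  apply: le_ereal_inf_tmp => _ [k _ <-]; apply: ereal_inf_lbound; exists (test_radius n k) => //.
  by apply: HV; have /andP[-> /lt_trans] := test_radiusP n k; apply.
- apply: ge_ereal_sup => _ [n _ <-].
  apply: (@lower_lip_ge _ _ _ (n.+1%:R^-1)%R); first by rewrite invr_gt0 ltr0n.
  move=> rho /andP[r0 rn].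
  rewrite leNgt; apply/negP => H.
  have D0 := dilation_at_ge0 u x r0.
  have Df : dilation_at u rho x \is a fin_num.
    by rewrite ge0_fin_numE//; apply: lt_le_trans H (leey _).
  pose D := fine (dilation_at u rho x).
  have DE : dilation_at u rho x = D%:E by rewrite fineK.
  have D0' : (0 <= D)%R by rewrite -lee_fin -DE.
  have [c Dc cE] : exists2 c, (D < c)%R &
      c%:E <= einfs (fun k => dilation_at u (test_radius n k) x) 0%N.
    move: H; rewrite DE; case: (einfs _ _) => [c| |//].
      by rewrite lte_fin => H; exists c.
    by move=> _; exists (D + 1)%R; rewrite ?leey// ltrDl.
  have c0 : (0 < c)%R by apply: le_lt_trans Dc.
  have Dr : (rho * D / c < rho)%R by rewrite ltr_pdivrMr// ltr_pM2l.
  have [q] := rat_in_itvoo Dr; rewrite in_itv/= => /andP[q1 q2].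
  have q0 : (0 < ratr q :> R)%R.
    by apply: le_lt_trans q1; rewrite divr_ge0 ?(ltW c0)// mulr_ge0// ltW.
  have tq : test_radius n (pickle q) = ratr q.
    by rewrite /test_radius pickleK q0 (lt_trans q2 rn).
  have : c%:E <= dilation_at u (ratr q) x.
    apply: le_trans cE _; rewrite -tq; apply: ereal_inf_lbound.
    by exists (pickle q).
  rewrite leNgt => /negP; apply.
  apply: le_lt_trans (_ : (rho * D / ratr q)%:E < _); last first.
    by rewrite ltr_pdivrMr// in q1; rewrite lte_fin ltr_pdivrMr// (mulrC c).
  apply: ge_ereal_sup => _ [y xy <-]; rewrite lee_fin ler_pM2r ?invr_gt0//.
  rewrite mulrC -ler_pdivrMr// -lee_fin -DE; apply: ereal_sup_ubound; exists y => //.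
  by apply: le_ball xy; exact: ltW.
Qed.

Lemma borel_lower_lip u : locally_lipschitz u -> borel_fun (lower_lip u).
Proof.
move=> Lu.
rewrite (_ : lower_lip u = fun x => esups (fun n => einfs (fun k => dilation_at u (test_radius n k) x) 0%N) 0%N).
  pose XB := g_sigma_algebraType (@open X).
  apply: (@measurable_fun_esups _ XB R setT (fun n x => einfs (fun k => dilation_at u (test_radius n k) x) 0%N)) => n.
  apply: (@measurable_fun_einfs _ XB R setT (fun k x => dilation_at u (test_radius n k) x)) => k.
  by apply: borel_dilation_at => //; case/andP: (test_radiusP n k).
by apply/funext => x; exact: lower_lip_countable.
Qed.

(** Along the 1-Lipschitz arc-length parametrization, a good radius rho at the
    point with parameter s controls the increment of u on the step from s to
    any parameter within rho, which is the hypothesis of the previous lemma on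
    increments. *)
Lemma lower_lip_upper_gradient u : locally_lipschitz u ->
  upper_gradient (EFin \o u) (lower_lip u).
Proof.
move=> Lu; split; [exact: borel_lower_lip|exact: lower_lip_ge0|].
move=> c rc lc; rewrite /upper_gradient_along /=.
set ell := fine (length c).
have l0 : (0 <= ell)%R := ell_ge0 rc.
pose h t := u (arc_param c t).
rewrite -(arc_param_lo rc) -(arc_param_hi rc) distrC.
apply: (@increment_le_integral_dini R ell h (fun t => lower_lip u (arc_param c t))) => //.
- move=> s e sI e0; have [d d0 Hd] := locally_lipschitz_near (arc_param c s) Lu e0.
  exists d => // t tI st; apply: Hd; apply: le_lt_trans st; exact: arc_param_lipschitz.
- exact: (line_measurable rc (borel_lower_lip Lu)).
- by move=> s _; split; [exact: lower_lip_ge0|exact: lower_lip_lty].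
move=> s e d /andP[s0 sl] e0 d0; set x := arc_param c s.
have Gf : lower_lip u x \is a fin_num.
  by rewrite ge0_fin_numE ?lower_lip_ge0// lower_lip_lty.
set G := fine (lower_lip u x).
have G0 : (0 <= G)%R by rewrite /G fine_ge0// lower_lip_ge0.
have lt1 : lower_lip u x < (G + e / 2)%:E by rewrite -(fineK Gf) lte_fin ltrDl divr_gt0.
have d1 : (0 < Num.min d (ell - s))%R by rewrite lt_min d0 subr_gt0.
have [rho /andP[r0 +] Hr] := lower_lip_lt lt1 d1.
rewrite lt_min => /andP[rd rl].
(* The ball of radius rho is open, so the step has to be shorter than rho; the loss is compensated by the slack e/2. *)
pose rho' := (rho * ((G + e / 2) / (G + e)))%R.
have Ge0 : (0 < G + e)%R by rewrite ltr_wpDl.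
have q0 : (0 < (G + e / 2) / (G + e))%R by rewrite divr_gt0// ltr_wpDl// divr_gt0.
have q1 : ((G + e / 2) / (G + e) < 1)%R by rewrite ltr_pdivrMr// mul1r ltrD2l; lra.
have rr : (0 < rho' < rho)%R by rewrite mulr_gt0//= gtr_pMr.
have /andP[rho'0 rho'r] := rr.
exists rho'; split; first by rewrite rho'0 (lt_trans rho'r).
  by have := lt_trans rho'r rl; lra.
have -> : ((G + e) * rho' = (G + e / 2) * rho)%R.
  by rewrite /rho'; field; rewrite gt_eqF.
rewrite distrC -ler_pdivrMr// -lee_fin; apply: le_trans (ltW Hr).
apply: ereal_sup_ubound; exists (arc_param c (s + rho')) => //; rewrite in_ball.
apply: le_lt_trans (arc_param_lipschitz rc _ _) _.
- by rewrite s0 ltW.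
- by rewrite -/ell addr_ge0// ?(ltW rho'0)//=; have := lt_trans rho'r rl; lra.
by rewrite opprD addNKr normrN gtr0_norm.
Qed.

End lower_lipschitz_constant.

(** * Lower limits and functions of bounded variation *)

Section lower_limits.
Context {R : realType}.
Local Open Scope ereal_scope.
Implicit Types (a b : nat -> \bar R).

Lemma limn_einf_ge0 a : (forall n, 0 <= a n) -> 0 <= limn_einf a.
Proof.
move=> a0; rewrite limn_einf_lim; apply: lime_ge; first exact: is_cvg_einfs.
by apply: nearW => n; apply: le_ereal_inf_tmp => _ [k _ <-].
Qed.

Lemma limn_einf_lt a c N : limn_einf a < c -> exists2 n, (N <= n)%N & a n < c.
Proof.
apply: contraPP => H; apply/negP; rewrite -leNgt limn_einf_lim.
apply: lime_ge; first exact: is_cvg_einfs.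
exists N => // n /= Nn; apply: le_ereal_inf_tmp => _ [k /= nk <-].
rewrite leNgt; apply/negP => ac; apply: H; exists k => //; exact: leq_trans Nn nk.
Qed.

Lemma le_limn_einf a b : (forall n, a n <= b n) -> limn_einf a <= limn_einf b.
Proof.
move=> ab; rewrite !limn_einf_lim; apply: lee_lim; [exact: is_cvg_einfs|exact: is_cvg_einfs|].
apply: nearW => n; apply: le_ereal_inf_tmp => _ [k nk <-].
by apply: le_trans (ab k); apply: ereal_inf_lbound; exists k.
Qed.

(** This makes the lower limit of energies superadditive on disjoint sets. *)
Lemma limn_einf_superadditive a b : (forall n, 0 <= a n) -> (forall n, 0 <= b n) ->
  limn_einf a + limn_einf b <= limn_einf (fun n => a n + b n).
Proof.
move=> a0 b0.
have [la lb] := (limn_einf_ge0 a0, limn_einf_ge0 b0).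
rewrite !limn_einf_lim in la lb *.
rewrite -limeD; [|exact: is_cvg_einfs|exact: is_cvg_einfs|exact: ge0_adde_def].
apply: lee_lim; [|exact: is_cvg_einfs|].
  by apply: is_cvgeD; [exact: ge0_adde_def|exact: is_cvg_einfs|exact: is_cvg_einfs].
apply: nearW => n; apply: le_ereal_inf_tmp => _ [k nk <-].
by apply: leeD; apply: ereal_inf_lbound; exists k.
Qed.

Lemma limn_einf_sum (I : Type) (s : seq I) (a : I -> nat -> \bar R) :
  (forall i n, 0 <= a i n) ->
  \sum_(i <- s) limn_einf (a i) <= limn_einf (fun n => \sum_(i <- s) a i n).
Proof.
move=> a0; elim: s => [|i s IH].
  by rewrite big_nil; apply: limn_einf_ge0 => n; rewrite big_nil.
rewrite big_cons; apply: le_trans (leeD (lexx _) IH) _.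
apply: le_trans (limn_einf_superadditive _ _) _ => //.
  by move=> n; apply: sume_ge0.
by apply: le_limn_einf => n; rewrite big_cons.
Qed.
End lower_limits.

Section bounded_variation.
Context {R : realType} {X : pmetricType R}.
Variable mu : {outer_measure set X -> \bar R}.
Hypothesis hX : metric_measure_space mu.
Hypothesis hdbl : doubling mu.
Local Open Scope ereal_scope.
Local Notation XM := (caratheodory_type mu).

(** The oscillation of f around its own mean is at most twice its
    oscillation around any constant m, and the latter is controlled by that of
    a function u close to f in L^1 on the ball. *)
Lemma mean_oscillation_le_near (f : X -> \bar R) (u : X -> \bar R) (B : set X) (m s t : R) :
  mu.-caratheodory B -> 0 < mu B -> mu B < +oo ->
  (cmeas mu).-integrable (B : set XM) f -> mu_measurable_fun mu u ->
  \int[cmeas mu]_(y in B) `|u y - f y| <= s%:E ->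
  \int[cmeas mu]_(y in B) `|u y - m%:E| <= t%:E ->
  avg mu B (fun y => `|f y - avg mu B f|) <= (2 * (s + t) / fine (mu B))%:E.
Proof.
move=> cB B0 fB fi mu_ Hs Ht.
have mB0 : (0 < fine (mu B))%R by rewrite fine_gt0// B0.
have mBf : mu B \is a fin_num by rewrite ge0_fin_numE.
have mfB := measurable_int (cmeas mu) fi.
have mabs (g : X -> \bar R) : measurable_fun (B : set XM) g -> measurable_fun (B : set XM) (fun y => `|g y|).
  by move=> mg; exact: measurableT_comp.
have muB : measurable_fun (B : set XM) u by exact: measurable_funTS.
have msub (g h : X -> \bar R) : measurable_fun (B : set XM) g -> measurable_fun (B : set XM) h ->
    measurable_fun (B : set XM) (fun y => `|g y - h y|).
  by move=> mg mh; apply: mabs; exact: emeasurable_funB.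
have Hfm : \int[cmeas mu]_(y in B) `|f y - m%:E| <= (s + t)%:E.
  apply: (@le_trans _ _ (\int[cmeas mu]_(y in B) (`|u y - f y| + `|u y - m%:E|))).
    apply: ge0_le_integral => //.
    - by apply: msub => //; exact: measurable_cst.
    - by apply: emeasurable_funD; apply: msub => //; exact: measurable_cst.
    - move=> y _; case: (f y) => [v| |]; case: (u y) => [w| |] //=; rewrite ?leey//.
      rewrite -EFinD lee_fin; have := ler_normD (v - w)%R (w - m)%R.
      by rewrite subrKA (distrC v w).
  rewrite ge0_integralD//; last 2 first.
  - exact: msub.
  - by apply: msub => //; exact: measurable_cst.
  by rewrite EFinD leeD.
have Hm := avg_sub_cst cB cB (@subset_refl _ _) B0 fB fi Hfm.
have Af := avg_fin_num cB fi.
rewrite /avg -/(avg mu B f) -(fineK Af); set c := fine (avg mu B f) in Hm *.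
rewrite [leLHS]muleC lee_pdivrMr// -EFinM divfK ?gt_eqF//.
apply: (@le_trans _ _ (\int[cmeas mu]_(y in B) (`|f y - m%:E| + cst `|m - c|%R%:E y))).
  apply: ge0_le_integral => //.
  - by apply: msub => //; exact: measurable_cst.
  - by apply: emeasurable_funD; [apply: msub => //; exact: measurable_cst|exact: measurable_cst].
  - move=> y _; case: (f y) => [v| |] //=.
    by rewrite -EFinD lee_fin; have := ler_normD (v - m)%R (m - c)%R; rewrite subrKA.
rewrite ge0_integralD//; last 2 first.
- by apply: (msub f (cst m%:E)) => //; exact: measurable_cst.
- by move=> y _; rewrite lee_fin.
rewrite integral_cst//.
have -> : (2 * (s + t))%:E = (s + t)%:E + (s + t)%:E by rewrite -EFinD; congr EFin; ring.
apply: leeD => //.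
change ((`|m - c|)%:E * mu B <= (s + t)%:E).
rewrite -(fineK mBf) -EFinM lee_fin -ler_pdivlMr// distrC.
exact: Hm.
Qed.

(** The maximal function of nu, the lower limit of the energies of the u_h, is
    finite almost everywhere.  At such a point x and for each small ball, the
    index h is chosen depending on the ball: late enough for u_h to be L^1-close
    to f on it, and such that the energy of u_h on the dilated ball is below
    (k+1) mu.  The Poincare inequality for u_h then passes to f. *)
Lemma bounded_variation_approx_differentiable (S : chart_system X) (f : X -> \bar R) :
  approx_differentiable_structure mu S -> weak_poincare mu 1 ->
  bounded_variation_fun mu f -> ae_approx_differentiable mu S f.
Proof.
move=> hS [lam [C [l1 C0 poin]]] [fL1 /ereal_inf_lt[_ [u [Lu uf] <-] Vfin]].
have l0 : (0 < lam)%R := lt_le_trans ltr01 l1.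
have mf : mu_measurable_fun mu f by case: fL1.
have intf x r : (cmeas mu).-integrable (ball x r : set XM) f.
  apply: (Lp_locally_integrable hX (lexx 1) fL1); first exact: ball_caratheodory.
  exact: mu_ball_fin.
pose g h := lower_lip (u h).
have g0 h x : 0 <= g h x by exact: lower_lip_ge0.
have mg h : mu_measurable_fun mu (g h).
  by apply: borel_mu_measurable => //; exact: borel_lower_lip.
have mu_ h : mu_measurable_fun mu (EFin \o u h).
  by apply: borel_mu_measurable => //; exact: borel_locally_lipschitz.
have mdf h : mu_measurable_fun mu (fun y => `|(u h y)%:E - f y|).
  by apply: measurableT_comp => //; exact: emeasurable_funB (mu_ h) mf.
pose nu A := limn_einf (fun h => \int[cmeas mu]_(x in A) g h x).
have nu0 A : 0 <= nu A by apply: limn_einf_ge0 => h; exact: integral_ge0.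
have V0 : 0 <= limn_einf (fun h => \int[cmeas mu]_x g h x) :> \bar R.
  by apply: limn_einf_ge0 => h; exact: integral_ge0.
pose V := limn_einf (fun h => \int[cmeas mu]_x g h x).
have nuV (s : seq (X * R)) : uniq s ->
    {in s &, forall a b, a != b -> ball a.1 a.2 `&` ball b.1 b.2 = set0} ->
    \sum_(b <- s) nu (ball b.1 b.2) <= (fine V)%:E.
  move=> us sd; rewrite fineK ?ge0_fin_numE//.
  apply: le_trans (limn_einf_sum s (fun b h => _)) _.
    by move=> b h; exact: integral_ge0.
  apply: le_limn_einf => h; exact: sum_disjoint_integral.
apply: (approx_differentiable_small_oscillation hX hdbl) => //.
  exact: (Lp_ae_fin hX hdbl (lexx 1) fL1).
apply: mu_sub0 (ae_maximal_finite hX hdbl nu0 nuV) => x Hx [k Hk]; apply: Hx.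
have [r0 r00 cvg0] := uf x.
(* The scale has to make the oscillation bound hold, the dilated ball small enough for the bound on nu, and the ball smaller than the one on which u_h converges to f. *)
pose K : R := (4 * C * k.+1%:R + lam * k.+1%:R + r0^-1)%R.
exists (Num.truncn K).+1 => r rpos rK.
set k' := (Num.truncn K).+1 in rK *.
have Kk : (K < k'%:R)%R by exact: truncnS_gt.
have t1 : (0 <= 4 * C * k.+1%:R)%R by rewrite !mulr_ge0// ltW.
have t2 : (0 <= lam * k.+1%:R)%R by rewrite mulr_ge0// ltW.
have t3 : (0 < r0^-1)%R by rewrite invr_gt0.
have {}rK : (r * K < 1)%R.
  apply: le_lt_trans rK; rewrite ler_pM2l// ltW//; apply: lt_trans Kk _.
  by rewrite ltr_nat.
have rr0 : (r < r0)%R.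
  rewrite -(invrK r0) -[ltRHS]div1r ltr_pdivlMr//; apply: le_lt_trans rK.
  by rewrite ler_pM2l// /K; lra.
have lrk : (lam * r * k.+1%:R < 1)%R.
  rewrite (mulrC lam) -mulrA; apply: le_lt_trans rK.
  by rewrite ler_pM2l// /K; lra.
have lr0 : (0 < lam * r)%R by rewrite mulr_gt0.
have cB := ball_caratheodory hX x r.
have B0 := mu_ball_gt0 hX hdbl x rpos.
have fB := mu_ball_fin hX hdbl x r.
have mB0 : (0 < fine (mu (ball x r)))%R by rewrite fine_gt0// B0.
have L0 := mu_ball_gt0 hX hdbl x lr0.
have fL := mu_ball_fin hX hdbl x (lam * r)%R.
have mL0 : (0 < fine (mu (ball x (lam * r)%R)))%R by rewrite fine_gt0// L0.
(* The error allowed in L^1 is the same as the bound given by the Poincare inequality. *)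
pose t := (C * r * k.+1%:R * fine (mu (ball x r)))%R.
have tpos : (0 < t)%R by rewrite !mulr_gt0.
have [N HN] : exists N, forall h, (N <= h)%N -> \int[cmeas mu]_(y in ball x r) `|(u h y)%:E - f y| <= t%:E.
  have /fine_cvgP[[N1 _ HN1] /cvgr0_norm_le /(_ t tpos)[N2 _ HN2]] := cvg0.
  exists (maxn N1 N2) => h; rewrite geq_max => /andP[h1 h2].
  apply: (@le_trans _ _ (\int[cmeas mu]_(y in ball x r0) `|(u h y)%:E - f y|)).
    apply: (@ge0_subset_integral _ XM R (cmeas mu)) => //.
    - exact: ball_caratheodory.
    - apply: measurable_funTS; exact: mdf.
    - by apply: le_ball; exact: ltW.
  rewrite -(fineK (HN1 h h1)) lee_fin; apply: le_trans (ler_norm _) _.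
  exact: (HN2 h h2).
have Hnu : nu (ball x (lam * r)%R) < k.+1%:R%:E * mu (ball x (lam * r)%R).
  apply: le_lt_trans (Hk _ lr0 lrk) _.
  by rewrite -(fineK (mu_ball_fin_num hX hdbl x (lam * r)%R)) -!EFinM lte_fin ltr_pM2r// ltr_nat.
have [h Nh Hh] := limn_einf_lt N Hnu.
have Hs := HN h Nh.
have intu : (cmeas mu).-integrable (ball x r : set XM) (EFin \o u h).
  apply/integrableP; split; first exact: measurable_funTS (mu_ h).
  apply: (@le_lt_trans _ _ (\int[cmeas mu]_(y in ball x r) (`|f y| + `|(u h y)%:E - f y|))).
    apply: ge0_le_integral => //.
    - by apply: measurable_funTS; apply: measurableT_comp => //; exact: mu_ h.
    - apply: measurable_funTS; apply: emeasurable_funD; first exact: measurableT_comp.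
      exact: mdf.
    - move=> y _ /=; case: (f y) => [v| |] /=; rewrite ?leey//.
      by rewrite -EFinD lee_fin; have := ler_normD v (u h y - v)%R; rewrite (addrC v) subrK.
  rewrite ge0_integralD//=; last 2 first.
  - by apply: measurable_funTS; exact: measurableT_comp.
  - by apply: measurable_funTS; exact: mdf.
  apply: lte_add_pinfty; last by apply: le_lt_trans Hs _; exact: ltry.
  by have /integrableP[] := intf x r.
have Af := avg_fin_num cB intu.
have Ht : \int[cmeas mu]_(y in ball x r) `|(EFin \o u h) y - (fine (avg mu (ball x r) (EFin \o u h)))%:E| <= t%:E.
  have := poin _ _ (mu_ h) (lower_lip_upper_gradient (Lu h)) x r rpos.
  rewrite {1}/avg muleC lee_pdivrMr// => H; rewrite fineK//; apply: le_trans H _.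
  rewrite -(fineK (mu_ball_fin_num hX hdbl x r)) /t EFinM lee_wpmul2r ?lee_fin ?(ltW mB0)//.
  rewrite -EFinM [leRHS]EFinM lee_wpmul2l ?lee_fin ?mulr_ge0 ?(ltW C0) ?(ltW rpos)//.
  rewrite /p_mean invr1 poweRe1; last first.
    by rewrite /avg mule_ge0 ?lee_fin ?invr_ge0 ?(ltW mL0)//; apply: integral_ge0 => y _; exact: poweR_ge0.
  rewrite /avg muleC lee_pdivrMr// fineK ?mu_ball_fin_num//.
  rewrite (@eq_integral _ XM R _ _ (g h)) => [|y _]; first exact: ltW.
  by rewrite poweRe1//; exact: g0.
apply: le_trans (mean_oscillation_le_near cB B0 fB (intf x r) (mu_ h) Hs Ht) _.
rewrite lee_fin ler_pdivrMr// /t.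
have -> : (2 * (C * r * k.+1%:R * fine (mu (ball x r)) + C * r * k.+1%:R * fine (mu (ball x r))) =
   4 * C * k.+1%:R * r * fine (mu (ball x r)))%R by ring.
by rewrite ler_pM2r// ler_pM2r//; move: Kk; rewrite /K; lra.
Qed.

End bounded_variation.

(** * Approximate differentiability of the three classes *)

Theorem corollary3p1 (R : realType) (X : pmetricType R)
    (mu : {outer_measure set X -> \bar R}) (p : \bar R)
    (hp : (1 <= p)%E)
    (hX : metric_measure_space mu)
    (hdbl : doubling mu)
    (hpoinc : weak_poincare mu p)
    (S : chart_system X)
    (hS : approx_differentiable_structure mu S) :
  (forall f : X -> \bar R, newtonian mu p f -> ae_approx_differentiable mu S f) /\
  (forall f : X -> \bar R, hajlasz_sobolev mu p f -> ae_approx_differentiable mu S f) /\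
  (p = 1%E ->
   forall f : X -> \bar R, bounded_variation_fun mu f -> ae_approx_differentiable mu S f).
Proof.
split; first by move=> f; exact: newtonian_approx_differentiable.
split; first by move=> f; exact: hajlasz_sobolev_approx_differentiable.
by move=> p1 f; subst p; exact: bounded_variation_approx_differentiable.
Qed.
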